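(* Let $\beta>1$ be irrational and let $c\in\mathbb Q$ with $c>0$. Let $\mathcal M_{\beta,c}$ be the set of Borel probability measures $\mu$ on $X$ with $(T_\beta)_*\mu=(T_{\beta+c})_*\mu=\mu$. Then $$\mathcal M_{\beta,c}=\begin{cases}\{(1-t)\delta_0+t\nu_\beta:0\le t\le 1\},& c=1\text{ and }\beta\in\mathcal E,\\ \{\delta_0\},&\text{otherwise}.\end{cases}$$ In the exceptional case ($c=1$ and $\beta\in\mathcal E$), $\nu_\beta=\nu_{\beta+1}$. If $\beta^2-u\beta-v=0$ with $u,v\in\mathbb N$, $1\le v\le u$, set $a=\beta-u=\frac{v}{\beta}\in(0,1)$; then the common measure $\nu_\beta$ has density $$\frac{d\nu_\beta}{d\lambda}(x)=\frac{1+\beta^{-1}\mathbf 1_{[0,a)}(x)}{1+a/\beta}.$$ For each $\mu\in\mathcal M_{\beta,c}$ in the exceptional case, the mixing parameter $t$ in the representation $\mu=(1-t)\delta_0+t\nu_\beta$ is unique and equals $1-\mu(\{0\})$. In every case, $\delta_0$ is the only element of $\mathcal M_{\beta,c}$ that is singular with respect to $\lambda$.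
   Context: $X=[0,1)$, and $\lambda$ is Lebesgue probability measure on $X$. For a real number $b>1$, the beta-transformation $T_b:X\to X$ is $T_b(x)=bx-\lfloor bx\rfloor$. For a Borel map $F:X\to X$, $F_*\mu$ denotes the pushforward, $F_*\mu(E)=\mu(F^{-1}E)$. $\delta_0$ is the unit point mass at $0$, and $\mathbf 1_A$ is the indicator function of $A$. For each $b>1$, $\nu_b$ denotes the R\'enyi--Parry measure, i.e. the unique $T_b$-invariant Borel probability measure on $X$ that is absolutely continuous with respect to $\lambda$ (its existence and uniqueness are classical). With $\mathbb N=\{1,2,\ldots\}$, set $$\mathcal E=\{b>1: b^2-ub-v=0\text{ for some }u,v\in\mathbb N\text{ with }1\le v\le u\}.$$ *)

(* Defs.v *)
From HB Require Import structures.
From mathcomp Require Import all_boot all_order all_algebra.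
From mathcomp Require Import all_classical all_reals all_analysis.
Set Implicit Arguments.
Unset Strict Implicit.
Unset Printing Implicit Defensive.
Import Order.TTheory GRing.Theory Num.Theory.
Import numFieldNormedType.Exports.
Local Open Scope classical_set_scope.
Local Open Scope ring_scope.

Definition ico01 (R : realType) : Type := {x : R | 0 <= x < 1}.

HB.instance Definition _ (R : realType) := Choice.on (ico01 R).

Fact ico01_0_subproof (R : realType) : 0 <= (0 : R) < 1.
Proof. by rewrite lexx ltr01. Qed.

Definition ico01_0 (R : realType) : ico01 R :=
  exist _ 0 (ico01_0_subproof R).

HB.instance Definition _ (R : realType) :=
  isPointed.Build (ico01 R) (ico01_0 R).

Definition ico01_val (R : realType) (x : ico01 R) : measurableTypeR R :=
  sval x.

(* The space [0, 1) with its Borel sigma-algebra, i.e. the trace of the Borel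
   sigma-algebra of the real line. *)
Definition X (R : realType) := g_sigma_algebra_preimageType (@ico01_val R).

HB.instance Definition _ (R : realType) := Measurable.on (X R).

Definition toR (R : realType) (x : X R) : R := sval (x : ico01 R).

Definition X0 (R : realType) : X R := ico01_0 R.

Definition lambda (R : realType) (A : set (X R)) : \bar R :=
  lebesgue_measure (@toR R @` A).

Section lambda_measure.
Context (R : realType).
Implicit Types A : set (X R).

Lemma toR_inj : injective (@toR R).
Proof. by move=> x y; exact: val_inj. Qed.

Lemma toR_image_preimage (B : set R) :
  @toR R @` (@toR R @^-1` B) = `[0, 1[ `&` B.
Proof.
apply/seteqP; split => [_ [x Bx <-]|r [r01 Br]].
  by split => //; rewrite /= in_itv; exact: (svalP (x : ico01 R)).
have r01' : 0 <= r < 1 by move: r01; rewrite /= in_itv.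
by exists (exist _ r r01' : ico01 R).
Qed.

Lemma measurable_toR_image A :
  measurable A -> measurable (@toR R @` A : set (measurableTypeR R)).
Proof.
case=> B mB; rewrite setTI => <-.
rewrite (_ : _ @` _ = `[0, 1[ `&` B); last exact: toR_image_preimage.
by apply: measurableI => //; exact: measurable_itv.
Qed.

Let lambda0 : lambda (set0 : set (X R)) = 0%E.
Proof. by rewrite /lambda image_set0 measure0. Qed.

Let lambda_ge0 A : (0 <= lambda A)%E.
Proof. exact: measure_ge0. Qed.

Let lambda_sigma_additive : semi_sigma_additive (@lambda R).
Proof.
move=> F mF tF mUF; rewrite /lambda image_bigcup.
apply: measure_semi_sigma_additive.
- by move=> n; exact: measurable_toR_image.
- apply/trivIsetP => i j _ _ ij; rewrite -subset0 => r [] [x Fx <-] [y Fy].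
  move/toR_inj => yx; subst y.
  move/trivIsetP : tF => /(_ i j Logic.I Logic.I ij); rewrite -subset0.
  by apply; split; eassumption.
- by rewrite -image_bigcup; exact: measurable_toR_image.
Qed.

HB.instance Definition _ := isMeasure.Build _ _ _
  (@lambda R) lambda0 lambda_ge0 lambda_sigma_additive.

Let lambda_setT : lambda (setT : set (X R)) = 1%E.
Proof.
rewrite /lambda -(preimage_setT (@toR R)) toR_image_preimage setIT.
by rewrite lebesgue_measure_itv /= lte_fin ltr01 sube0.
Qed.

HB.instance Definition _ := Measure_isProbability.Build _ _ _
  (@lambda R) lambda_setT.

End lambda_measure.

Fact beta_transformation_subproof (R : realType) (b : R) (x : X R) :
  0 <= b * toR x - (Num.floor (b * toR x))%:~R < 1.
Proof. by rewrite subr_ge0 floor_le /= ltrBlDl -intrD1 floorD1_gt. Qed.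

Definition beta_transformation (R : realType) (b : R) (x : X R) : X R :=
  (exist _ (b * toR x - (Num.floor (b * toR x))%:~R)
     (beta_transformation_subproof b x) : ico01 R).

Notation T_ b := (beta_transformation b).

(* A measure is a total function on sets, whose values outside the
   sigma-algebra are irrelevant: two measures are the same when they agree on
   measurable sets. *)
Definition eq_measure d (T : measurableType d) (R : realType)
    (m1 m2 : set T -> \bar R) :=
  forall A, measurable A -> m1 A = m2 A.

Notation "m1 =m m2" := (eq_measure m1 m2) (at level 70, no associativity).

Definition invariant_measure (R : realType) (F : X R -> X R)
    (mu : probability (X R) R) :=
  pushforward mu F =m mu.

Definition joint_invariant (R : realType) (beta : R) (c : rat) :
    set (probability (X R) R) :=
  [set mu | invariant_measure (T_ beta) mu /\
            invariant_measure (T_ (beta + ratr c)) mu].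

Definition mutually_singular d (T : measurableType d) (R : realType)
    (m1 m2 : set T -> \bar R) :=
  exists A, [/\ measurable A, m1 A = 0%E & m2 (~` A) = 0%E].

(* For b > 1 such a measure exists and is unique (up to [=m]), by the classical
   theorem of Renyi and Parry, so [get] picks it. *)
Definition renyi_parry (R : realType) (b : R) : probability (X R) R :=
  get [set nu : probability (X R) R |
       invariant_measure (T_ b) nu /\ nu `<< @lambda R].

Notation nu_ b := (renyi_parry b).

Definition quadratic_coeffs (R : realType) (b : R) (u v : nat) :=
  (1 <= v <= u)%N /\ b ^+ 2 - u%:R * b - v%:R = 0.

Definition exceptional_bases (R : realType) : set R :=
  [set b | 1 < b /\ exists u v : nat, quadratic_coeffs b u v].

Definition exceptional (R : realType) (beta : R) (c : rat) :=
  c = 1 /\ exceptional_bases beta.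

Definition mixture (R : realType) (t : R) (m1 m2 : set (X R) -> \bar R)
    (A : set (X R)) : \bar R :=
  ((1 - t)%:E * m1 A + t%:E * m2 A)%E.

Definition delta0 (R : realType) : probability (X R) R := \d_(X0 R).

Definition mixing_parameter (R : realType) (beta : R)
    (mu : probability (X R) R) (t : R) :=
  0 <= t <= 1 /\ mu =m mixture t (delta0 R) (nu_ beta).

(* Main.v *)
Require Import Defs.
From HB Require Import structures.
From mathcomp Require Import all_boot all_order all_algebra.
From mathcomp Require Import all_classical all_reals all_analysis.
From mathcomp Require Import measurable_realfun zify ring lra.
Import Order.TTheory GRing.Theory Num.Theory.
Import numFieldNormedType.Exports.
Local Open Scope classical_set_scope.
Local Open Scope ring_scope.

(* Write b = beta + c.  The composites T_b T_beta and T_beta T_b are both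
   multiplication by beta * b up to the integer parts carried along, so they
   differ, after multiplication by the denominator q of c, by a rotation by
   q * beta * j, where j x = floor (b x) - floor (beta x).  Both composites
   preserve a jointly invariant mu, so a weighted sum of the conditional laws
   given j is invariant under an irrational rotation, hence is a multiple of
   Lebesgue measure, of mass the integral of j, which is c times the mean of mu.
   So a singular mu has mean 0, that is, mu is the point mass at 0.
   The absolutely continuous part is invariant too, and absolutely continuous
   T_beta-invariant measures are unique by ergodicity, so it is proportional to
   Parry's measure, whose density is a sum of indicators of intervals ending at
   the orbit of 1.  Comparing the slopes at 0 and 1 and the kinks of its
   distribution function with those of its T_b-image shows that T_b-invariance
   forces the orbit of 1 to be 1, a, 0 and b = beta + 1. *)

(** The weights come from the identity (R - 1)(1 + R + ... + R^(j-1)) = R^j - 1 for a rotation R: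
    adding, over i < j, the laws of q T_b T_beta x rotated i times gives a measure whose defect
    under one more rotation is the difference of the laws of q T_beta T_b x and q T_b T_beta x
    modulo 1, which is 0. This constrains only the average, not mu; singularity carries the
    information back, since a singular mu makes every layer of the average singular. An absolutely
    continuous mu passes this test with a positive mean of j, hence the separate comparison with
    Parry's measure. Atoms are not excluded beforehand, so rotation invariance is exploited through
    a function that is monotone up to a linear term rather than continuous. The orbit of 1 may be
    infinite a priori, so Parry's density is handled through partial sums with geometric tails. *)

Set Implicit Arguments.
Unset Strict Implicit.
Unset Printing Implicit Defensive.

(** * The unit interval and fractional parts *)

Section basics.
Context {R : realType}.
Implicit Types (t s : R) (x : X R).

Definition below t : set (X R) := [set x | toR x < t].

Lemma toR_ge0 x : 0 <= toR x.
Proof. by case: x => x /= /andP[]. Qed.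

Lemma toR_lt1 x : toR x < 1.
Proof. by case: x => x /= /andP[]. Qed.

Lemma measurable_toR : measurable_fun setT (@toR R : X R -> measurableTypeR R).
Proof. by move=> _ B mB; exists B. Qed.

Lemma measurable_below t : measurable (below t).
Proof.
rewrite -[below t]setTI.
have := @measurable_toR measurableT `]-oo, t[%classic (measurable_itv _).
by rewrite (_ : @toR R @^-1` _ = below t)//; apply/seteqP; split => x /=; rewrite in_itv.
Qed.

Lemma below1 t : 1 <= t -> below t = setT.
Proof.
by move=> t1; apply/seteqP; split => // x _; exact: lt_le_trans (toR_lt1 x) t1.
Qed.

Lemma below0 t : t <= 0 -> below t = set0.
Proof.
move=> t0; apply/seteqP; split => // x /= xt.
by have := lt_le_trans xt t0; rewrite ltNge toR_ge0.
Qed.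

(** The pi-lambda theorem: the sets [below t] are stable under intersection and generate the Borel
    sets, and parameters outside [0, 1] only give the empty set or the whole space. *)
Lemma cdf_unique (m1 m2 : {measure set (X R) -> \bar R}) :
  (m1 setT < +oo)%E ->
  (forall t, 0 <= t <= 1 -> m1 (below t) = m2 (below t)) ->
  forall A, measurable A -> m1 A = m2 A.
Proof.
move=> m1T m12 A mA.
apply: (@measure_unique _ R (X R) [set B | exists t, B = below t] (fun _ => setT)) => //.
- rewrite -[RHS](_ : preimage_set_system setT (@toR R : X R -> measurableTypeR R) measurable = _) //.
  have -> : (measurable : set (set (measurableTypeR R))) = <<s @measurable_realfun.RGenInftyO.G R >>.
    exact: measurable_realfun.RGenInftyO.measurableE.
  rewrite -g_sigma_preimageE; congr (<<s _ >>).
  apply/seteqP; split => [_ [_ [t ->] <-]|_ [t ->]].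
    by exists t; apply/seteqP; split => x /=; rewrite in_itv/=; [case|].
  exists `]-oo, t[%classic; first by exists t.
  by apply/seteqP; split => x /=; rewrite in_itv/=; [case|].
- move=> _ _ [s ->] [t ->]; exists (Num.min s t).
  by apply/seteqP; split => x; rewrite /below/= lt_min => /andP.
- by move=> _; exists 1; rewrite below1.
- by rewrite bigcup_const//; exists 0%N.
- move=> _ [t ->]; have [t0|t0] := leP t 0.
    by rewrite below0// !measure0.
  have [t1|t1] := leP t 1; first by apply: m12; rewrite (ltW t0).
  by rewrite below1 ?(ltW t1)// -(below1 (lexx 1)) m12// ler01 lexx.
Qed.

Lemma lambda_itv s t : 0 <= s -> s <= t -> t <= 1 ->
  lambda [set x | s <= toR x < t] = (t - s)%:E.
Proof.
move=> s0 st t1.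
rewrite /lambda (_ : _ @` _ = `[s, t[%classic); last first.
  apply/seteqP; split => [_ [x /= xst <-]|r /=]; rewrite ?in_itv//=.
  move=> /andP[sr rt]; have r01 : 0 <= r < 1 by rewrite (le_trans s0 sr) (lt_le_trans rt t1).
  by exists (exist _ r r01 : ico01 R) => //=; rewrite sr.
rewrite lebesgue_measure_itv/= lte_fin; case: ltP => [_|ts]; first by rewrite EFinB.
by have -> : t = s; [apply/le_anti; rewrite ts st|rewrite subrr].
Qed.

Lemma lambda_below t : 0 <= t <= 1 -> lambda (below t) = t%:E.
Proof.
move=> /andP[t0 t1]; rewrite -[X in X%:E](subr0 t) -lambda_itv//; congr lambda.
by apply/seteqP; split => x /=; rewrite toR_ge0.
Qed.

Definition fracpart (r : R) : R := r - (Num.floor r)%:~R.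

Lemma frac_ge0 r : 0 <= fracpart r.
Proof. by rewrite subr_ge0 floor_le. Qed.

Lemma frac_lt1 r : fracpart r < 1.
Proof. by rewrite /fracpart ltrBlDl -intrD1 floorD1_gt. Qed.

Lemma frac_id (r : R) : 0 <= r < 1 -> fracpart r = r.
Proof.
by move=> r01; rewrite /fracpart (_ : Num.floor r = 0) ?subr0//; apply/floor_def; rewrite add0r.
Qed.

Lemma fracDz (r : R) (k : int) : fracpart (r + k%:~R) = fracpart r.
Proof. by rewrite /fracpart floorDrz ?intr_int// intrKfloor intrD; ring. Qed.

Lemma frac_eq (r s : R) (k : int) : r - s = k%:~R -> fracpart r = fracpart s.
Proof. by move=> rs; rewrite -(subrK s r) rs addrC fracDz. Qed.

Lemma toR_T (b : R) x : toR (T_ b x) = fracpart (b * toR x).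
Proof. by []. Qed.

Lemma measurable_frac : measurable_fun setT (fracpart : R -> R).
Proof.
apply: measurable_funB => //; apply: nondecreasing_measurable => //.
by move=> x y xy; rewrite ler_int; exact: le_floor.
Qed.

Lemma measurable_toX (f : X R -> X R) :
  measurable_fun setT (fun x => toR (f x)) -> measurable_fun setT f.
Proof.
move=> mf _ _ [B mB <-]; rewrite !setTI.
by have := mf measurableT B mB; rewrite setTI.
Qed.

Lemma measurable_T (b : R) : measurable_fun setT (T_ b).
Proof.
apply: measurable_toX; apply: (measurableT_comp measurable_frac).
apply: measurable_funM => //; exact: measurable_toR.
Qed.

Lemma toX_subproof (r : R) : 0 <= fracpart r < 1.
Proof. by rewrite frac_ge0 frac_lt1. Qed.
Definition toX (r : R) : X R := exist _ (fracpart r) (toX_subproof r) : ico01 R.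

Definition pushm (m : {measure set (X R) -> \bar R}) (f : X R -> X R)
  (mf : measurable_fun setT f) : set (X R) -> \bar R := pushforward m f.

Section pushm.
Variables (m : {measure set (X R) -> \bar R}) (f : X R -> X R) (mf : measurable_fun setT f).
Let pushm0 : pushm m mf set0 = 0%E.
Proof. by rewrite /pushm /pushforward preimage_set0 measure0. Qed.
Let pushm_ge0 A : (0 <= pushm m mf A)%E.
Proof. exact: measure_ge0. Qed.
Let pushm_sigma_additive : semi_sigma_additive (pushm m mf).
Proof. exact: (@measure_semi_sigma_additive _ _ _ (pushforward m f)). Qed.
HB.instance Definition _ := isMeasure.Build _ _ _ (pushm m mf) pushm0 pushm_ge0 pushm_sigma_additive.
End pushm.

End basics.

(** * The image of Lebesgue measure under a beta-transformation; ergodicity *)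

Section transfer.
Context {R : realType}.
Implicit Types (t s : R) (x : X R).

Lemma frac_int t (k : int) : k%:~R <= t < (k + 1)%:~R -> fracpart t = t - k%:~R.
Proof. by move=> /floor_def; rewrite /fracpart => ->. Qed.

Lemma measurable_preimage (f : X R -> X R) (E : set (X R)) :
  measurable_fun setT f -> measurable E -> measurable (f @^-1` E).
Proof. by move=> mf mE; rewrite -[_ @^-1` _]setTI; exact: mf. Qed.

Variable b : R.
Hypothesis b0 : 0 < b.

(** On the branch starting at k / b the map is x -> b x - k, so the new points with image below [s]
    fill the interval from k / b to [m]. The closed bound b t <= k + 1 lets this serve as the
    induction step for full branches. *)
Lemma lambda_branch (k : nat) t s : 0 <= s <= 1 ->
  k%:R <= b * t -> b * t <= k%:R + 1 -> t <= 1 ->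
  lambda (below t `&` T_ b @^-1` below s) =
  (lambda (below (k%:R / b) `&` T_ b @^-1` below s) +
   (b^-1 * Num.min (b * t - k%:R) s)%:E)%E.
Proof.
move=> /andP[s0 s1] kt tk t1.
pose m := Num.min t ((k%:R + s) / b).
have mE : m - k%:R / b = b^-1 * Num.min (b * t - k%:R) s.
  rewrite [RHS]mulrC minr_pMl ?invr_ge0 ?ltW// mulrBl mulrAC mulfV ?gt_eqF// mul1r.
  by rewrite /m addr_minl mulrDl [_ + s / b - _]addrAC subrr add0r.
have kb0 : 0 <= k%:R / b by rewrite divr_ge0// ltW.
have kbt : k%:R / b <= t by rewrite ler_pdivrMr// mulrC.
rewrite -mE -lambda_itv//; last 2 first.
- by rewrite le_min kbt/= ler_pM2r ?invr_gt0// lerDl.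
- by rewrite ge_min t1.
have mT : measurable (T_ b @^-1` below s).
  by apply: measurable_preimage; [exact: measurable_T|exact: measurable_below].
rewrite -measureU//; first congr lambda.
- apply/seteqP; split => x.
  + move=> [/= xt xs]; case: (ltP (toR x) (k%:R / b)) => xk; [by left|right].
    rewrite /= lt_min; apply/andP; split => //.
    rewrite ltr_pdivlMr// mulrC -ltrBlDl.
    have : fracpart (b * toR x) < s by [].
    rewrite (@frac_int _ k)//.
    rewrite -pmulrn intrD -pmulrn; apply/andP; split.
      by rewrite mulrC -ler_pdivrMr.
    by apply: lt_le_trans tk; rewrite ltr_pM2l.
  + move=> [[/= xk xs]|]; first by split => //; exact: lt_le_trans xk kbt.
    rewrite /= lt_min => /and3P[xk xt]; rewrite ltr_pdivlMr// mulrC => xs.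
    split => //; suff : fracpart (b * toR x) < s by [].
    rewrite (@frac_int _ k)//.
      by rewrite -pmulrn ltrBlDl.
    rewrite -pmulrn intrD -pmulrn; apply/andP; split.
      by rewrite mulrC -ler_pdivrMr.
    by apply: lt_le_trans tk; rewrite ltr_pM2l.
- exact: measurableI (measurable_below _) _.
- rewrite (_ : mkset _ = below m `\` below (k%:R / b)).
    by apply: measurableD; exact: measurable_below.
  apply/seteqP; split => x; rewrite /below/=.
    by move=> /andP[xk xm]; split => //; apply/negP; rewrite -leNgt.
  by move=> [-> /negP]; rewrite -leNgt => ->.
- apply/seteqP; split => // x [[/= xk _] /andP[+ _]].
  by rewrite leNgt xk.
Qed.

Lemma lambda_branches (k : nat) s : 0 <= s <= 1 -> k%:R / b <= 1 ->
  lambda (below (k%:R / b) `&` T_ b @^-1` below s) = (b^-1 * (k%:R * s))%:E.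
Proof.
move=> s01; elim: k => [|k IH] kb1.
  by rewrite !mul0r mulr0 below0// set0I measure0.
have kb : k%:R / b <= 1.
  by apply: le_trans kb1; rewrite ler_pM2r ?invr_gt0// ler_nat.
have bk : b * (k.+1%:R / b) = k%:R + 1 by rewrite mulrCA divff ?gt_eqF// mulr1 natr1.
rewrite (lambda_branch (k := k)) ?bk ?lerDl//.
rewrite IH// [k%:R + 1]addrC addrK -EFinD; case/andP: s01 => _ s1; rewrite min_r//.
by rewrite -mulrDr -natr1 mulrDl mul1r.
Qed.

Lemma lambda_below_T_below t s : 0 <= t <= 1 -> 0 <= s <= 1 ->
  lambda (below t `&` T_ b @^-1` below s) =
  (b^-1 * ((Num.floor (b * t))%:~R * s + Num.min (fracpart (b * t)) s))%:E.
Proof.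
move=> /andP[t0 t1] s01.
have : 0 <= Num.floor (b * t) by rewrite floor_ge0 mulr_ge0// ltW.
have := frac_ge0 (b * t); have := frac_lt1 (b * t); rewrite /fracpart.
case: (Num.floor _) => [] k //; rewrite -pmulrn => k1 k0 _.
rewrite (lambda_branch (k := k))//; last 2 first.
- by rewrite -subr_ge0.
- by rewrite -lerBlDl ltW.
rewrite lambda_branches//; first by rewrite -EFinD mulrDr.
by rewrite (le_trans _ t1)// ler_pdivrMr// mulrC -subr_ge0.
Qed.

Lemma below_setI t s : below t `&` below s = below (Num.min t s).
Proof.
apply/seteqP; split => x; rewrite /below/= lt_min; first by case=> -> ->.
by move=> /andP.
Qed.

(** The transfer operator on the indicator of [0, t): [Num.floor (b * t)] full branches cover the
    whole space and the last, partial one covers an interval starting at 0, each with weight 1 / b.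
    The invariance of the explicit densities below rests on this formula. *)
Lemma lambda_below_T t (E : set (X R)) : 0 <= t <= 1 -> measurable E ->
  lambda (below t `&` T_ b @^-1` E) =
  (b^-1%:E * ((Num.floor (b * t))%:~R%:E * lambda E +
             lambda (below (fracpart (b * t)) `&` E)))%E.
Proof.
move=> t01 mE.
have f0 : 0 <= (Num.floor (b * t))%:~R :> R.
  by case/andP: t01 => t0 _; rewrite ler0z floor_ge0 mulr_ge0// ltW.
have b'0 : 0 <= b^-1 by rewrite invr_ge0 ltW.
pose m1 : {measure set (X R) -> \bar R} :=
  pushm (mrestr (@lambda R) (measurable_below t)) (measurable_T b).
pose m2 : {measure set (X R) -> \bar R} :=
  mscale (NngNum b'0) (measure_add (mscale (NngNum f0) (@lambda R))
    (mrestr (@lambda R) (measurable_below (fracpart (b * t))))).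
have m1E A : m1 A = lambda (below t `&` T_ b @^-1` A).
  by rewrite setIC.
have m2E A : m2 A = (b^-1%:E * ((Num.floor (b * t))%:~R%:E * lambda A +
             lambda (below (fracpart (b * t)) `&` A)))%E.
  rewrite setIC; congr (_ * _)%E; exact: measure_addE.
rewrite -m1E -m2E; apply: cdf_unique => // [|s s01].
  by rewrite m1E preimage_setT setIT lambda_below// ltry.
rewrite m1E m2E lambda_below_T_below// lambda_below// below_setI.
rewrite lambda_below//.
by case/andP: s01 => s0 s1; rewrite le_min frac_ge0 s0 ge_min s1 orbT.
Qed.

Lemma lambda_fin (A : set (X R)) : measurable A -> lambda A \is a fin_num.
Proof. exact: fin_num_measure. Qed.

End transfer.

Lemma le0_geometric (R : realType) (q a : R) :
  0 <= q < 1 -> (forall n, a <= q ^+ n) -> a <= 0.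
Proof.
move=> /andP[q0 q1] aq.
have c : (fun n => q ^+ n) @ \oo --> (0 : R) by apply: cvg_expr; rewrite ger0_norm.
rewrite -(cvg_lim _ c)//; apply: limr_ge; first exact: cvgP c.
exact: nearW.
Qed.

Section ergodicity.
Context {R : realType}.
Variable b : R.
Hypothesis b1 : 1 < b.

(* The defect [lambda (E `&` [0, t)) - t * lambda E] is multiplied by [b^-1]
   under [t |-> fracpart (b * t)], hence vanishes. *)
Lemma invariant_set_trivial (E : set (X R)) : measurable E ->
  T_ b @^-1` E = E -> lambda E = 0%E \/ lambda E = 1%E.
Proof.
move=> mE TE; have b0 : 0 < b by rewrite (lt_trans ltr01).
have mI t : measurable (below t `&` E) by apply: measurableI => //; exact: measurable_below.
pose l := fine (lambda E).
have lE : lambda E = l%:E by rewrite fineK// lambda_fin.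
pose d t := fine (lambda (below t `&` E)) - t * l.
have dE t : 0 <= t <= 1 -> d t = b^-1 * d (fracpart (b * t)).
  move=> t01; rewrite /d -[in LHS]TE lambda_below_T// lE.
  have -> : lambda (below (fracpart (b * t)) `&` E) = (fine (lambda (below (fracpart (b * t)) `&` E)))%:E.
    by rewrite fineK// lambda_fin.
  rewrite -EFinM/=.
  rewrite (_ : fracpart (b * t) * l = (b * t - (Num.floor (b * t))%:~R) * l)//.
  by field; rewrite gt_eqF.
have d_le1 t : 0 <= t <= 1 -> `|d t| <= 1.
  move=> /andP[t0 t1]; rewrite ler_norml /d.
  have l01 : 0 <= l <= 1.
    by rewrite -!lee_fin -lE measure_ge0 probability_le1.
  have : 0 <= fine (lambda (below t `&` E)) <= 1.
    by rewrite -!lee_fin fineK ?lambda_fin// measure_ge0 probability_le1.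
  have : 0 <= t * l <= 1.
    by case/andP: l01 => l0 l1; rewrite mulr_ge0//= mulr_ile1.
  by lra.
have d_small n t : 0 <= t <= 1 -> `|d t| <= b^-1 ^+ n.
  elim: n t => [t|n IH t t01]; first by rewrite expr0; exact: d_le1.
  rewrite dE// exprS normrM [`|b^-1|]ger0_norm ?invr_ge0 ?(ltW b0)//.
  by rewrite ler_pM2l ?invr_gt0// IH// frac_ge0 ltW// frac_lt1.
have d0 t : 0 <= t <= 1 -> d t = 0.
  move=> t01; apply/eqP; rewrite -normr_le0.
  apply: (@le0_geometric _ b^-1) => [|n]; last exact: d_small.
  by rewrite invr_ge0 (ltW b0) invf_lt1.
have l0 : 0 <= l by rewrite -lee_fin -lE.
pose m1 : {measure set (X R) -> \bar R} := mrestr (@lambda R) mE.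
pose m2 : {measure set (X R) -> \bar R} := mscale (NngNum l0) (@lambda R).
(* Evaluated at [E] itself, the equality of the two measures reads l = l * l. *)
have : m1 E = m2 E.
  apply: cdf_unique => //; first by rewrite /m1/= /mrestr/= setTI lE ltry.
  move=> t t01; rewrite /m1/= /mrestr /m2/= /mscale/= lambda_below// -EFinM.
  rewrite -[LHS]fineK ?lambda_fin//; congr EFin.
  by have := d0 _ t01; rewrite /d => /subr0_eq ->; rewrite mulrC.
rewrite /m1/= /mrestr /m2/= /mscale/= setIid lE -EFinM => -[] /eqP.
rewrite -subr_eq0 -{1}[l]mulr1 -mulrBr mulf_eq0 subr_eq0 => /orP[]/eqP => [->|<-].
  by left.
by right.
Qed.

End ergodicity.

(** * Hahn sets invariant under a map *)

Section invariant_hahn.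
Context d (T : measurableType d) (R : realType).
Variables (nu1 nu2 : {finite_measure set T -> \bar R}) (f : T -> T).
Hypothesis mf : measurable_fun setT f.
Hypothesis inv1 : forall A, measurable A -> nu1 (f @^-1` A) = nu1 A.
Hypothesis inv2 : forall A, measurable A -> nu2 (f @^-1` A) = nu2 A.

Let s A : R := fine (nu1 A) - fine (nu2 A).

Let sDI A B : measurable A -> measurable B -> s A = s (A `\` B) + s (A `&` B).
Proof.
move=> mA mB; have mD := measurableD mA mB; have mI := measurableI _ _ mA mB.
rewrite /s (measureDI nu1 mA mB) (measureDI nu2 mA mB).
by rewrite !fineD ?fin_num_measure//; ring.
Qed.

Let s_preimage A : measurable A -> s (f @^-1` A) = s A.
Proof. by move=> mA; rewrite /s inv1// inv2. Qed.

Let s_max : exists2 P, measurable P & forall A, measurable A -> s A <= s P.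
Proof.
pose c1 := charge_of_finite_measure nu1.
pose c2 := charge_of_finite_measure nu2.
have [P [N [[mP posP] [mN negN] PN PN0]]] := Hahn_decomposition (cadd c1 (copp c2)).
have sE A : measurable A -> cadd c1 (copp c2) A = (s A)%:E.
  move=> mA; rewrite /cadd/= /copp/= /s EFinB !fineK ?fin_num_measure//.
exists P => // A mA; rewrite (sDI mA mP) (sDI mP mA) setIC lerD2r.
have mAP := measurableD mA mP; have mPA := measurableD mP mA.
apply: (@le_trans _ _ 0).
  rewrite -lee_fin -sE//; apply: negN => // x [Ax Px].
  by have : (P `|` N) x; [rewrite PN|case].
by rewrite -lee_fin -sE//; apply: posP => // x [].
Qed.

(* Sets of maximal charge are stable under preimages by [f], finite unions and
   monotone limits, so the limit superior of the preimages of a Hahn set is one. *)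
Lemma invariant_hahn : exists E, [/\ measurable E, f @^-1` E = E &
  forall A, measurable A ->
    fine (nu1 A) - fine (nu2 A) <= fine (nu1 E) - fine (nu2 E)].
Proof.
have [P mP Pmax] := s_max.
pose M A := measurable A /\ s A = s P.
have mpre A : measurable A -> measurable (f @^-1` A).
  by move=> mA; rewrite -[_ @^-1` _]setTI; exact: mf.
have Mpre A : M A -> M (f @^-1` A).
  by move=> [mA sA]; split; [exact: mpre|rewrite s_preimage].
have MU A B : M A -> M B -> M (A `|` B).
  move=> [mA sA] [mB sB]; have mU := measurableU _ _ mA mB.
  (* The charges of the union and of the intersection add up to twice the maximum, so neither can
     fall short of it. *)
  split => //; have := sDI mU mB; rewrite setDUl setDv setU0.
  rewrite (_ : (A `|` B) `&` B = B); last by apply/setIidPr => x; right.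
  have := sDI mA mB; have := Pmax _ (measurableI _ _ mA mB); have := Pmax _ mU.
  by rewrite sA sB; lra.
have Mlim (F : (set T)^nat) E : (forall n, M (F n)) -> measurable E ->
    (nu1 \o F) n @[n --> \oo] --> nu1 E -> (nu2 \o F) n @[n --> \oo] --> nu2 E -> M E.
  move=> MF mE F1 F2; split => //.
  have c : (fine \o (nu1 \o F)) n - (fine \o (nu2 \o F)) n @[n --> \oo] --> s E.
    by apply: cvgB; apply: fine_cvg; rewrite fineK// fin_num_measure.
  have : (fun n => (fine \o (nu1 \o F)) n - (fine \o (nu2 \o F)) n) = (fun=> s P).
    by apply/funext => n; rewrite -(MF n).2.
  by move=> eqF; move: c; rewrite eqF => /cvg_lim <-//; rewrite lim_cst.
pose F n := iter n (preimage f) P.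
have MF n : M (F n) by elim: n => [|n IH]; [split|exact: Mpre].
pose U n := \big[setU/set0]_(i < n.+1) F i.
have MUn n : M (U n).
  elim: n => [|n IH]; first by rewrite /U big_ord1; exact: (MF 0%N).
  by rewrite /U big_ord_recr/=; exact: MU IH (MF n.+1).
pose V := \bigcup_n F n.
have UV : V = \bigcup_n U n.
  apply/seteqP; split => x [n _ Fx]; last first.
    by move: Fx; rewrite /U -bigcup_mkord => -[k _ Fk]; exists k.
  by exists n => //; rewrite /U big_ord_recr/=; right.
have mV : measurable V by apply: bigcupT_measurable => n; exact: (MF n).1.
have MV : M V.
  have ndU : {homo U : n m / (n <= m)%N >-> (n <= m)%O}.
    move=> n m nm; apply/subsetPset => x; rewrite /U -!bigcup_mkord => -[k kn Fk].
    by exists k => //=; exact: leq_trans kn _.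
  apply: (Mlim U) => //; rewrite UV; apply: nondecreasing_cvg_mu => //.
  - by move=> n; exact: (MUn n).1.
  - by rewrite -UV.
  - by move=> n; exact: (MUn n).1.
  - by rewrite -UV.
have fV : f @^-1` V `<=` V.
  by move=> x [n _ Fx]; exists n.+1.
(* The preimage of [V] lies in [V], so the iterated preimages decrease and their intersection is
   exactly invariant, not merely up to a null set. *)
pose W n := iter n (preimage f) V.
have MW n : M (W n) by elim: n => [//|n IH]; exact: Mpre.
have WS n : W n.+1 `<=` W n.
  elim: n => [//|n IH] x; exact: IH.
have niW : {homo W : n m / (n <= m)%N >-> (m <= n)%O}.
  apply: homo_leq => //; first by move=> A B C AB BC; exact: le_trans BC AB.
  by move=> n; apply/subsetPset; exact: WS.
have mE : measurable (\bigcap_n W n) by apply: bigcapT_measurable => n; exact: (MW n).1.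
exists (\bigcap_n W n); split => //.
  apply/seteqP; split => x Wx n _; last exact: (Wx n.+1).
  by case: n => [|n]; [apply: fV|]; exact: Wx 0%N Logic.I || exact: Wx n Logic.I.
suff [_ sE] : M (\bigcap_n W n) by move=> A mA; rewrite -/(s A) -/(s _) sE; exact: Pmax.
apply: (Mlim W) => //; apply: nonincreasing_cvg_mu => //.
- by rewrite ltey_eq fin_num_measure//; exact: (MW 0%N).1.
- by move=> n; exact: (MW n).1.
- by rewrite ltey_eq fin_num_measure//; exact: (MW 0%N).1.
- by move=> n; exact: (MW n).1.
Qed.
End invariant_hahn.

(** * Null part and uniqueness of absolutely continuous invariant measures *)

Lemma fin_num_addI (R : realDomainType) (x y z : \bar R) :
  z \is a fin_num -> (x + z = y + z)%E -> x = y.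
Proof. by case: x y z => [x||] [y||] [z||]// _ [] /addIr ->. Qed.

Section null_part.
Context d (T : measurableType d) (R : realType).
Variables (mu : {finite_measure set T -> \bar R}) (la : {measure set T -> \bar R}).

(** Exhaustion: a union of null sets whose masses approach the supremum attains it, and a null set
    with mass outside the union would exceed it. The restriction of [mu] to [N] is its singular
    part. *)
Lemma maximal_null_set : exists N, [/\ measurable N, la N = 0%E &
  forall A, measurable A -> la A = 0%E -> mu (A `\` N) = 0%E].
Proof.
pose S := [set fine (mu A) | A in [set A | measurable A /\ la A = 0%E]].
have S0 : S 0 by exists set0; rewrite ?measure0.
have ubS : ubound S (fine (mu setT)).
  move=> _ [A [mA _] <-]; apply: fine_le; rewrite ?fin_num_measure//.
  by apply: le_measure; rewrite ?inE.
have hS : has_sup S by split; [exists 0|exists (fine (mu setT))].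
have /choice[F F_] (n : nat) : exists A, [/\ measurable A, la A = 0%E &
    sup S - n.+1%:R^-1 < fine (mu A)].
  have e0 : 0 < n.+1%:R^-1 :> R by rewrite invr_gt0.
  by have [_ [A [mA lA] <-] lt] := sup_adherent e0 hS; exists A.
have mF n : measurable (F n) by have [] := F_ n.
have lF n : la (F n) = 0%E by have [] := F_ n.
have mN : measurable (\bigcup_n F n) by exact: bigcupT_measurable.
have lN : la (\bigcup_n F n) = 0%E.
  apply/eqP; rewrite -measure_le0.
  apply: (le_trans (measure_sigma_subadditive _ mF mN (@subset_refl _ _))).
  by rewrite eseries0.
exists (\bigcup_n F n); split => // A mA lA.
have mAN := measurableD mA mN.
have lU : la (A `|` \bigcup_n F n) = 0%E.
  apply/eqP; rewrite -measure_le0; apply: (le_trans (measureU2 _ mA mN)).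
  by rewrite [X in (X + _)%E]lA [X in (_ + X)%E]lN adde0.
have mU := measurableU _ _ mA mN.
have supU : fine (mu (A `|` \bigcup_n F n)) <= sup S.
  by apply: ub_le_sup; [exists (fine (mu setT))|exists (A `|` \bigcup_n F n)].
have supN : sup S <= fine (mu (\bigcup_n F n)).
  apply/ler_addgt0Pl => e e0.
  have [n _ ne] : exists2 n : nat, True & n.+1%:R^-1 < e.
    exists (Num.truncn e^-1) => //; rewrite invf_plt ?posrE//.
    exact: truncnS_gt.
  have [_ _] := F_ n; rewrite ltrBlDl => /ltW supn.
  apply: (le_trans supn); apply: lerD; first exact: ltW.
  apply: fine_le; rewrite ?fin_num_measure//.
  by apply: le_measure; rewrite ?inE//; exact: bigcup_sup.
rewrite -[LHS]fineK ?fin_num_measure//; congr EFin; apply/le_anti; rewrite fine_ge0 ?measure_ge0// andbT.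
have : mu (A `|` \bigcup_n F n) = (mu (A `\` \bigcup_n F n) + mu (\bigcup_n F n))%E.
  rewrite -measureU//; first by rewrite setUDl setDv setD0.
  by apply/seteqP; split=> // x [[]].
move=> /(congr1 (@fine R)); rewrite fineD ?fin_num_measure// => eqU.
by have := le_trans supU supN; rewrite eqU gerDr.
Qed.

Variables (N : set T) (f : T -> T).
Hypotheses (mN : measurable N) (lN : la N = 0%E).
Hypothesis Nmax : forall A, measurable A -> la A = 0%E -> mu (A `\` N) = 0%E.
Hypothesis mf : measurable_fun setT f.
Hypothesis muf : forall A, measurable A -> mu (f @^-1` A) = mu A.
Hypothesis laf : forall A, measurable A -> la A = 0%E -> la (f @^-1` A) = 0%E.

Let muDI A B : measurable A -> measurable B ->
  (mu A = mu (A `\` B) + mu (A `&` B))%E.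
Proof. exact: measureDI. Qed.

(** The preimage of [N] is [la]-null, so [mu] does not charge it outside [N]; as both sets have the
    same finite mass, they agree up to a [mu]-null set. *)
Lemma invariant_null_part B : measurable B ->
  mu (f @^-1` B `&` N) = mu (B `&` N).
Proof.
move=> mB.
have mpre A : measurable A -> measurable (f @^-1` A).
  by move=> mA; rewrite -[_ @^-1` _]setTI; exact: mf.
have mfN := mpre _ mN; have mfB := mpre _ mB.
have d1 : mu (f @^-1` N `\` N) = 0%E by apply: Nmax => //; exact: laf.
have d2 : mu (N `\` f @^-1` N) = 0%E.
  move: (muDI mfN mN) (muDI mN mfN); rewrite d1 add0e muf// [N `&` _]setIC => e1 e2.
  apply: (@fin_num_addI _ _ _ (mu (f @^-1` N `&` N))).
    by rewrite fin_num_measure//; exact: measurableI.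
  by rewrite add0e -e2.
have key C D : measurable C -> measurable D -> mu (C `\` D) = 0%E ->
    mu (f @^-1` B `&` C) = mu (f @^-1` B `&` C `&` D).
  move=> mC mD CD; rewrite (muDI (measurableI _ _ mfB mC) mD).
  rewrite (_ : mu (_ `\` _) = 0%E) ?add0e//.
  apply: subset_measure0 CD => //.
  - by apply: measurableD => //; exact: measurableI.
  - exact: measurableD.
  - by move=> x [[_ Cx] Dx].
rewrite -(muf (measurableI _ _ mB mN)) preimage_setI.
by rewrite (key _ _ mN mfN)// (key _ _ mfN mN)// -setIA [N `&` _]setIC setIA.
Qed.

Lemma invariant_ac_part B : measurable B ->
  mu (f @^-1` B `\` N) = mu (B `\` N).
Proof.
move=> mB; have mfB : measurable (f @^-1` B) by rewrite -[_ @^-1` _]setTI; exact: mf.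
have := muDI mfB mN; rewrite invariant_null_part// muf// (muDI mB mN).
by move/esym/fin_num_addI; apply; rewrite fin_num_measure//; exact: measurableI.
Qed.

End null_part.

Section unique.
Context {R : realType}.
Variable b : R.
Hypothesis b1 : 1 < b.

Lemma lambda_preimage0 (A : set (X R)) : measurable A -> lambda A = 0%E ->
  lambda (T_ b @^-1` A) = 0%E.
Proof.
move=> mA A0; have b0 : 0 < b by rewrite (lt_trans ltr01).
rewrite -[_ @^-1` _]setTI -(below1 (lexx 1)) lambda_below_T// ?ler01 ?lexx//.
rewrite A0 mule0 add0e.
rewrite (_ : lambda _ = 0%E) ?mule0//.
apply: (@subset_measure0 _ _ _ (@lambda R) _ A) => //.
by apply: measurableI => //; exact: measurable_below.
Qed.

(** The invariant Hahn set has Lebesgue measure 0 or 1 by ergodicity, so both measures give it the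
    same mass and the largest value of their difference is 0. Equal total masses turn this
    inequality, applied to complements, into equality. Masses are not normalised because
    restrictions and multiples get compared later. *)
Lemma ac_invariant_unique (nu1 nu2 : {finite_measure set (X R) -> \bar R}) :
  (forall A, measurable A -> nu1 (T_ b @^-1` A) = nu1 A) ->
  (forall A, measurable A -> nu2 (T_ b @^-1` A) = nu2 A) ->
  content_dominates (@lambda R) nu1 -> content_dominates (@lambda R) nu2 ->
  nu1 setT = nu2 setT -> forall A, measurable A -> nu1 A = nu2 A.
Proof.
move=> inv1 inv2 ac1 ac2 eqT.
have [E [mE TE maxE]] := invariant_hahn (measurable_T b) inv1 inv2.
have eqE : nu1 E = nu2 E.
  have [E0|E1] := invariant_set_trivial b1 mE TE; first by rewrite ac1// ac2.
  have C0 : lambda (~` E) = 0%E.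
    rewrite (_ : lambda (~` E) = (1 - lambda E)%E); first by rewrite E1 subee.
    exact: probability_setC.
  have full (nu : {finite_measure set (X R) -> \bar R}) :
      content_dominates (@lambda R) nu -> nu setT = nu E.
    move=> ac; rewrite -(setUv E); have mC := measurableC mE.
    rewrite (_ : nu (E `|` ~` E) = (nu E + nu (~` E))%E); first by rewrite [X in (_ + X)%E]ac ?adde0.
    by apply: measureU => //; rewrite setICr.
  by rewrite -full// eqT full.
have le A : measurable A -> fine (nu1 A) <= fine (nu2 A).
  by move=> mA; have := maxE _ mA; rewrite eqE subrr subr_le0.
have compl (nu : {finite_measure set (X R) -> \bar R}) A : measurable A ->
    fine (nu setT) = fine (nu A) + fine (nu (~` A)).
  move=> mA; rewrite -fineD ?fin_num_measure//; last exact: measurableC.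
  rewrite -(setUv A); congr fine; apply: measureU; rewrite ?setICr//.
  exact: measurableC.
move=> A mA; rewrite -[LHS]fineK ?fin_num_measure// -[RHS]fineK ?fin_num_measure//.
congr EFin; apply/le_anti/andP; split; first exact: le.
have := compl nu1 _ mA; have := compl nu2 _ mA; have := le _ (measurableC mA).
by rewrite eqT; lra.
Qed.
End unique.

(** * Irrational rotations *)

Section irrational_rotation.
Context {R : realType}.
Implicit Types (al : R) (H : R -> R).

Lemma irrational_int_comb al (m n : int) :
  irrational al -> m%:~R + n%:~R * al = 0 -> n = 0.
Proof.
move=> irr mn; apply/eqP; apply: contra_notT irr => n0.
have n0R : n%:~R != 0 :> R by rewrite intr_eq0.
exists (- m%:~R / n%:~R) => //.
rewrite fmorph_div/= rmorphN/= !ratr_int.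
have -> : al = (n%:~R * al) / n%:~R by rewrite mulrAC divff// mul1r.
by congr (_ / _); apply/eqP; rewrite eq_sym -subr_eq0 opprK addrC mn.
Qed.

(** Dirichlet's pigeonhole: among K + 1 multiples of [al], two fractional parts fall in the same
    interval of length 1 / K; irrationality makes their difference nonzero. *)
Lemma irrational_small_comb al (e : R) : irrational al -> 0 < e ->
  exists m n : int, 0 < m%:~R + n%:~R * al < e.
Proof.
move=> irr e0; pose K := (Num.truncn e^-1).+1.
have K0 : 0 < K%:R :> R by rewrite ltr0n.
have Ke : K%:R^-1 < e by rewrite invf_plt ?posrE// truncnS_gt.
have box (k : nat) : exists i : 'I_K, i%:R <= K%:R * fracpart (k%:R * al) < i%:R + 1.
  have f0 := frac_ge0 (k%:R * al); have f1 := frac_lt1 (k%:R * al).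
  have := floor_itv (K%:R * fracpart (k%:R * al)).
  have : 0 <= Num.floor (K%:R * fracpart (k%:R * al)) by rewrite floor_ge0 mulr_ge0// ltW.
  case: (Num.floor _) => [] i // _; rewrite intrD -!pmulrn => iK.
  have ltiK : (i < K)%N.
    rewrite -(ltr_nat R); case/andP: iK => iK _; apply: le_lt_trans iK _.
    by rewrite gtr_pMr.
  by exists (Ordinal ltiK).
have /choice[F F_] : forall k : 'I_K.+1, exists i : 'I_K,
  i%:R <= K%:R * fracpart (k%:R * al) < i%:R + 1 by move=> k; exact: box.
have /injectivePn[k [l kl Fkl]] : ~~ injectiveb F.
  by apply/negP => /injectiveP /leq_card; rewrite !card_ord ltnn.
wlog le : k l kl Fkl / fracpart (k%:R * al) <= fracpart (l%:R * al).
  move=> wl; have [|/ltW] := leP (fracpart (k%:R * al)) (fracpart (l%:R * al)); first exact: wl.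
  by apply: wl; [rewrite eq_sym|].
pose m := Num.floor (k%:R * al) - Num.floor (l%:R * al).
pose n : int := l%:Z - k%:Z.
have mnE : m%:~R + n%:~R * al = fracpart (l%:R * al) - fracpart (k%:R * al).
  by rewrite /m /n /fracpart !intrB -!pmulrn; ring.
exists m, n; apply/andP; split; last first.
  rewrite mnE; apply: lt_trans Ke; rewrite -(ltr_pM2l K0) divff ?gt_eqF// mulrBr.
  by move: (F_ k) (F_ l); rewrite Fkl; lra.
rewrite lt_neqAle mnE subr_ge0 le andbT -mnE eq_sym.
apply/eqP => /(irrational_int_comb irr)/eqP; rewrite subr_eq0 => /eqP[] lk.
by move/eqP: kl; apply; apply/val_inj.
Qed.

Lemma periodic_int H w : (forall t, H (t + w) = H t) ->
  forall (k : int) t, H (t + k%:~R * w) = H t.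
Proof.
move=> Hw; have Hn (n : nat) t : H (t + n%:R * w) = H t.
  elim: n t => [|n IH] t; first by rewrite mul0r addr0.
  by rewrite -natr1 mulrDl mul1r addrA Hw IH.
case=> n t; first by rewrite -pmulrn Hn.
by rewrite NegzE mulrNz mulNr -pmulrn -[LHS](Hn n.+1) subrK.
Qed.

(** The one-sided bound says that [H t + C * t] is nondecreasing, so [H] may jump upwards. Shifting
    [s] by multiples of a small period [w] to a point within [w] beyond [t] loses at most [C * w],
    whence H t <= H s + e; the roles of s and t can be exchanged. *)
Lemma rotation_invariant_const H al C : irrational al -> 0 <= C ->
  (forall t, H (t + 1) = H t) -> (forall t, H (t + al) = H t) ->
  (forall s t, s <= t -> H s - C * (t - s) <= H t) ->
  forall s t, H s = H t.
Proof.
move=> irr C0 H1 Hal Hlip.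
suff le s t : H t <= H s by move=> s t; apply/le_anti; rewrite !le.
apply/ler_addgt0Pr => e e0.
have e1 : 0 < e / (C + 1) by rewrite divr_gt0// ltr_wpDl.
have [m [n /andP[w0 we]]] := irrational_small_comb irr e1.
set w := m%:~R + n%:~R * al in w0 we.
have Hw u : H (u + w) = H u.
  rewrite /w addrA (periodic_int Hal) -[m%:~R]mulr1; exact: periodic_int.
pose k := Num.ceil ((t - s) / w).
rewrite -(periodic_int Hw k s); set u := s + _.
have tu : t <= u.
  by rewrite /u -lerBlDl -ler_pdivrMr//; exact: ceil_ge.
have ut : u - t <= w.
  have : (k%:~R - 1) * w <= t - s.
    by rewrite -ler_pdivlMr// ltW//; have := ceilB1_lt ((t - s) / w); rewrite intrB.
  by rewrite /u mulrBl mul1r; lra.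
have := Hlip _ _ tu; rewrite lerBlDr => /le_trans; apply; rewrite lerD2l.
apply: (@le_trans _ _ (C * (e / (C + 1)))).
  by rewrite ler_wpM2l// (le_trans ut)// ltW.
rewrite mulrCA ger_pMr// ler_pdivrMr ?mul1r ?lerDl// ltr_wpDl//.
Qed.

Lemma frac_shift_ge (w s t : R) : s <= t -> fracpart (w - s) - (t - s) <= fracpart (w - t).
Proof.
move=> st; have : (Num.floor (w - t))%:~R <= (Num.floor (w - s))%:~R :> R.
  by rewrite ler_int le_floor// lerD2l lerN2.
by rewrite /fracpart; lra.
Qed.

(** The indicator matters: averaged over [w], it turns the mean of [fracpart (w - t)] into a
    distribution function plus an affine function of [t]. *)
Lemma frac_shiftE (w t : R) : 0 <= t <= 1 ->
  fracpart (w - t) = fracpart w - t + (fracpart w < t)%R%:R.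
Proof.
move=> /andP[t0 t1]; have f0 := frac_ge0 w; have f1 := frac_lt1 w.
case: ltP => ft.
  rewrite (@frac_eq _ (w - t) (fracpart w - t + 1) (Num.floor w - 1)).
    by rewrite frac_id//; lra.
  by rewrite /fracpart intrB; ring.
rewrite (@frac_eq _ (w - t) (fracpart w - t) (Num.floor w)).
  by rewrite frac_id ?addr0//; lra.
by rewrite /fracpart; ring.
Qed.

Lemma telescope_lt (J n : nat) (g : nat -> R) : (n <= J)%N ->
  \sum_(i < J) (if i%:R < n%:R :> R then g i.+1 - g i else 0) = g n - g 0.
Proof.
move=> nJ; under eq_bigr do rewrite ltr_nat.
rewrite -big_mkcond/= -(big_ord_widen _ (fun i => g i.+1 - g i))//.
by rewrite -(big_mkord xpredT (fun i => g i.+1 - g i)) telescope_sumr.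
Qed.

End irrational_rotation.

(** * Integrals of bounded measurable functions *)

Section bounded_measurable.
Context {R : realType}.
Implicit Types (f g : X R -> R).

Definition bounded_measurable f :=
  measurable_fun setT f /\ exists M, forall x, `|f x| <= M.
Local Notation bm := bounded_measurable.

Lemma bm_cst (k : R) : bm (fun=> k).
Proof. by split => //; exists `|k|. Qed.

Lemma bmD f g : bm f -> bm g -> bm (fun x => f x + g x).
Proof.
move=> [mf [M fM]] [mg [N gN]]; split; first exact: measurable_funD.
by exists (M + N) => x; rewrite (le_trans (ler_normD _ _))// lerD.
Qed.

Lemma bmM f g : bm f -> bm g -> bm (fun x => f x * g x).
Proof.
move=> [mf [M fM]] [mg [N gN]]; split; first exact: measurable_funM.
by exists (M * N) => x; rewrite normrM ler_pM.
Qed.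

Lemma bmB f g : bm f -> bm g -> bm (fun x => f x - g x).
Proof.
move=> [mf [M fM]] [mg [N gN]]; split; first exact: measurable_funB.
by exists (M + N) => x; rewrite (le_trans (ler_normB _ _))// lerD.
Qed.

Lemma bm_sum (J : nat) (f : nat -> X R -> R) : (forall i, bm (f i)) ->
  bm (fun x => \sum_(i < J) f i x).
Proof.
move=> bf; elim: J => [|J IH].
  by under eq_fun do rewrite big_ord0; exact: bm_cst.
by under eq_fun do rewrite big_ord_recr; exact: bmD.
Qed.

Lemma bm_if (p : X R -> bool) f g : measurable_fun setT p -> bm f -> bm g ->
  bm (fun x => if p x then f x else g x).
Proof.
move=> mp [mf [M fM]] [mg [N gN]]; split; first exact: measurable_fun_ifT.
exists (Num.max M N) => x; rewrite le_max.
by case: ifP => _; rewrite ?fM ?gN ?orbT.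
Qed.

Lemma bm_frac f : measurable_fun setT f -> bm (fun x => fracpart (f x)).
Proof.
move=> mf; split; first exact: (measurableT_comp measurable_frac).
by exists 1 => x; rewrite ger0_norm ?frac_ge0// ltW// frac_lt1.
Qed.

Lemma bm_comp (T : X R -> X R) f : measurable_fun setT T -> bm f ->
  bm (fun x => f (T x)).
Proof.
by move=> mT [mf [M fM]]; split; [exact: measurableT_comp|exists M].
Qed.

Lemma bm_toR : bm (@toR R).
Proof.
split; first exact: measurable_toR.
by exists 1 => x; rewrite ger0_norm ?toR_ge0// ltW// toR_lt1.
Qed.

Variable mu : {finite_measure set (X R) -> \bar R}.

Lemma bm_integrable f : bm f -> mu.-integrable setT (EFin \o f).
Proof.
move=> [mf [M fM]]; apply: measurable_bounded_integrable => //.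
  by rewrite ltey_eq fin_num_measure.
exists M; split; first exact: num_real.
by move=> M' MM' x _; exact: le_trans (fM x) (ltW MM').
Qed.

Lemma bm_intD f g : bm f -> bm g ->
  \int[mu]_x (f x + g x) = \int[mu]_x f x + \int[mu]_x g x.
Proof. by move=> bf bg; apply: RintegralD => //; exact: bm_integrable. Qed.

Lemma bm_intB f g : bm f -> bm g ->
  \int[mu]_x (f x - g x) = \int[mu]_x f x - \int[mu]_x g x.
Proof. by move=> bf bg; apply: RintegralB => //; exact: bm_integrable. Qed.

Lemma bm_intZ (k : R) f : bm f -> \int[mu]_x (k * f x) = k * \int[mu]_x f x.
Proof. by move=> bf; apply: RintegralZl => //; exact: bm_integrable. Qed.

Lemma bm_int_le f g : bm f -> bm g -> (forall x, f x <= g x) ->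
  \int[mu]_x f x <= \int[mu]_x g x.
Proof. by move=> bf bg fg; apply: le_Rintegral => //; exact: bm_integrable. Qed.

Lemma bm_int_sum (J : nat) (f : nat -> X R -> R) : (forall i, bm (f i)) ->
  \int[mu]_x (\sum_(i < J) f i x) = \sum_(i < J) \int[mu]_x f i x.
Proof.
move=> bf; elim: J => [|J IH].
  rewrite big_ord0; under eq_Rintegral do rewrite big_ord0.
  by rewrite Rintegral_cst ?mul0r.
rewrite big_ord_recr/= -IH -bm_intD//; last exact: bm_sum.
by apply: eq_Rintegral => x _; rewrite big_ord_recr.
Qed.

Lemma bm_int_invariant (T : X R -> X R) f :
  measurable_fun setT T -> (forall A, measurable A -> mu (T @^-1` A) = mu A) ->
  bm f -> \int[mu]_x f (T x) = \int[mu]_x f x.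
Proof.
move=> mT muT bf; rewrite /Rintegral; congr fine.
have mEf : measurable_fun setT (EFin \o f) by apply/measurable_EFinP; exact: bf.1.
transitivity (\int[pushforward mu T]_x (f x)%:E)%E.
  rewrite integral_pushforward//.
  by apply: (@bm_integrable (f \o T)); exact: bm_comp.
by apply: eq_measure_integral => A mA _; exact: muT.
Qed.

Lemma bm_int_indicator (A : set (X R)) : measurable A ->
  \int[mu]_x \1_A x = fine (mu A).
Proof. by move=> mA; rewrite /Rintegral integral_indic// setIT. Qed.

End bounded_measurable.

(** * The commutator of two beta-transformations *)

(** [F] is the image under x -> q x - i of the part of [N] in the branch [i / q, (i + 1) / q). By
    the transfer formula for T_q this branch contributes mass lambda F / q to the preimage of [F],
    and it contributes only points of [N]. *)
Lemma lambda_affine_preimage0 {R : realType} (q i : nat) (N : set (X R)) :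
  (i < q)%N -> measurable N -> lambda N = 0%E ->
  lambda ((fun y => toX ((toR y + i%:R) / q%:R)) @^-1` N) = 0%E.
Proof.
move=> iq mN N0; set F := _ @^-1` N.
have q0 : 0 < q%:R :> R by rewrite ltr0n (leq_ltn_trans _ iq).
have mF : measurable F.
  apply: measurable_preimage => //; apply: measurable_toX.
  apply: (@bm_frac _ _ _).1; apply: measurable_funM => //.
  by apply: measurable_funD => //; exact: measurable_toR.
have key (k : nat) : (k <= q)%N ->
    lambda (below (k%:R / q%:R) `&` T_ q%:R @^-1` F) = (q%:R^-1 * k%:R * fine (lambda F))%:E.
  move=> kq; rewrite lambda_below_T//; last first.
    by rewrite divr_ge0//= ler_pdivrMr// mul1r ler_nat.
  rewrite mulrCA divff ?gt_eqF// mulr1 /fracpart.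
  rewrite (_ : Num.floor k%:R = k :> int); last by rewrite pmulrn intrKfloor.
  rewrite -pmulrn subrr below0// set0I measure0 adde0.
  by rewrite -[in LHS](fineK (lambda_fin mF)) -!EFinM mulrA.
have sub : below (i.+1%:R / q%:R) `&` T_ q%:R @^-1` F `<=`
    (below (i%:R / q%:R) `&` T_ q%:R @^-1` F) `|` N.
  move=> x [xi Fx]; have [xi'|xi'] := ltP (toR x) (i%:R / q%:R); [by left|right].
  move: Fx; rewrite /F /preimage/=; congr N; apply: toR_inj.
  suff : fracpart ((fracpart (q%:R * toR x) + i%:R) / q%:R) = toR x by [].
  rewrite (@frac_int _ (q%:R * toR x) i).
    rewrite -pmulrn subrK mulrAC divff ?gt_eqF// mul1r.
    by rewrite frac_id// toR_ge0 toR_lt1.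
  rewrite intrD -pmulrn natr1; apply/andP; split.
    by rewrite mulrC -ler_pdivrMr.
  by rewrite mulrC -ltr_pdivlMr.
have mT : measurable (T_ q%:R @^-1` F) by apply: measurable_preimage => //; exact: measurable_T.
have mk (k : nat) : measurable (below (k%:R / q%:R : R) `&` T_ q%:R @^-1` F).
  by apply: measurableI => //; exact: measurable_below.
have : (lambda (below (i.+1%:R / q%:R) `&` T_ q%:R @^-1` F) <=
        lambda (below (i%:R / q%:R) `&` T_ q%:R @^-1` F))%E.
  apply: (@le_trans _ _ (lambda ((below (i%:R / q%:R) `&` T_ q%:R @^-1` F) `|` N))).
    by apply: (@le_measure _ _ _ (@lambda R)); rewrite ?inE//; exact: measurableU.
  apply: (le_trans (@measureU2 _ _ _ (@lambda R) _ _ _ _)) => //.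
  by rewrite [X in (_ + X)%E]N0 adde0.
rewrite !key//; last exact: ltnW.
rewrite lee_fin -!mulrA ler_pM2l ?invr_gt0// -natr1 mulrDl mul1r gerDl => F0.
by rewrite -(fineK (lambda_fin mF)); congr EFin; apply/le_anti; rewrite F0 fine_ge0// measure_ge0.
Qed.

Section rotation_trick.
Context {R : realType}.
Variable mu : {finite_measure set (X R) -> \bar R}.
Variables (beta : R) (c : rat).
Hypotheses (beta_irr : irrational beta) (c_gt0 : 0 < c).
Let b := beta + ratr c.
Hypothesis mu_beta : forall A, measurable A -> mu (T_ beta @^-1` A) = mu A.
Hypothesis mu_b : forall A, measurable A -> mu (T_ b @^-1` A) = mu A.

Local Notation bm := bounded_measurable.

Let q : nat := `|denq c|%N.

Let q_gt0 : 0 < q%:R :> R.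
Proof. by rewrite ltr0n absz_gt0 denq_neq0. Qed.

Let qc : q%:R * ratr c = (numq c)%:~R :> R.
Proof.
have dq : (q%:R : R) = (denq c)%:~R by rewrite pmulrn /q gez0_abs// denq_ge0.
by rewrite dq /ratr mulrCA divff ?mulr1// intr_eq0 denq_neq0.
Qed.

(** Written without floors, so that integration against an invariant measure cancels the last two
    terms and leaves [ratr c] times the mean; [jumpE] shows that the values are integers. *)
Let jump (x : X R) : R := ratr c * toR x + toR (T_ beta x) - toR (T_ b x).

Let c0 : 0 < ratr c :> R. Proof. by rewrite ltr0q. Qed.

Let jumpE x : jump x = (Num.floor (b * toR x))%:~R - (Num.floor (beta * toR x))%:~R.
Proof. by rewrite /jump !toR_T /fracpart /b; ring. Qed.

Let bm_jump : bm jump.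
Proof.
apply: bmB; last by apply: bm_comp; [exact: measurable_T|exact: bm_toR].
apply: bmD; last by apply: bm_comp; [exact: measurable_T|exact: bm_toR].
by apply: bmM; [exact: bm_cst|exact: bm_toR].
Qed.

Let J : nat := (Num.truncn (ratr c + 1 : R)).+1.

Let jump_nat x : exists2 n : nat, jump x = n%:R & (n <= J)%N.
Proof.
have : 0 <= Num.floor (b * toR x) - Num.floor (beta * toR x).
  by rewrite subr_ge0 le_floor// ler_wpM2r ?toR_ge0// /b lerDl ltW.
have := jumpE x; rewrite -intrB; case: (_ - _) => // n jn _.
exists n => //; rewrite -ltnS; apply: leqW; rewrite -(ltr_nat R).
apply: lt_le_trans (ltW (truncnS_gt (ratr c + 1))).
have : jump x < ratr c + 1.
  rewrite /jump; have := toR_lt1 (T_ beta x); have := toR_ge0 (T_ b x).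
  have : ratr c * toR x <= ratr c by rewrite ler_piMr// ltW// toR_lt1.
  by lra.
by rewrite jn.
Qed.

Let AA (x : X R) : X R := T_ b (T_ beta x).
Let BB (x : X R) : X R := T_ beta (T_ b x).

(* Both composites are [beta * b * x] up to the carried integer parts: after
   multiplication by the denominator of [c] only the carries seen through
   [beta] survive modulo 1. *)
Let commutator x : exists k : int,
  q%:R * toR (BB x) - (q%:R * toR (AA x) - q%:R * beta * jump x) = k%:~R.
Proof.
set k0 := Num.floor (beta * toR x).
exists (numq c * k0 + q%:Z * (Num.floor (b * toR (T_ beta x)) -
                              Num.floor (beta * toR (T_ b x)))).
rewrite intrD !intrM intrB -qc -pmulrn /jump /AA /BB !toR_T.
rewrite [in X in q%:R * X - _]/fracpart [in X in _ - (q%:R * X - _)]/fracpart.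
by rewrite /k0 /fracpart /b; ring.
Qed.

Let w (i : nat) (x : X R) : R := q%:R * toR (AA x) - i%:R * (q%:R * beta).

Let measurable_A : measurable_fun setT AA.
Proof. by apply: (measurableT_comp (measurable_T _)); exact: measurable_T. Qed.

Let measurable_B : measurable_fun setT BB.
Proof. by apply: (measurableT_comp (measurable_T _)); exact: measurable_T. Qed.

Let bm_w i : bm (w i).
Proof.
apply: bmB; last exact: bm_cst.
by apply: bmM; [exact: bm_cst|apply: bm_comp => //; exact: bm_toR].
Qed.

Let measurable_active i : measurable_fun setT (fun x => i%:R < jump x).
Proof. by apply: measurable_fun_ltr => //; exact: bm_jump.1. Qed.

(* With [H t] the integral of the sum of the terms, [H t + t * \int jump] is, up
   to a constant, the mass of [0, t) under the sum over [i] of the laws of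
   [w i] modulo 1 restricted to [i < jump]. *)
Let term (t : R) (i : nat) (x : X R) : R :=
  if i%:R < jump x then fracpart (w i x - t) else 0.

Let bm_term t i : bm (term t i).
Proof.
apply: bm_if; [exact: measurable_active| |exact: bm_cst].
by apply: bm_frac; exact: (bmB (bm_w i) (bm_cst t)).1.
Qed.

Let H (t : R) : R := \int[mu]_x (\sum_(i < J) term t i x).

Let H_per1 t : H (t + 1) = H t.
Proof.
apply: eq_Rintegral => x _; apply: eq_bigr => i _; rewrite /term.
by case: ifP => // _; apply: (@frac_eq _ _ _ (-1)); rewrite /=; ring.
Qed.

(** Shifting [t] by q beta turns layer i into layer i + 1, so the difference of the two sums
    telescopes pointwise to [f (BB x) - f (AA x)], by [commutator]; its integral is 0 because both
    composites preserve [mu]. *)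
Let H_perq t : H (t + q%:R * beta) = H t.
Proof.
apply/eqP; rewrite -subr_eq0 /H -bm_intB; try exact: bm_sum.
pose f x := fracpart (q%:R * toR x - t).
have bf : bm f.
  apply: bm_frac; apply: (bmB _ (bm_cst t)).1.
  by apply: bmM; [exact: bm_cst|exact: bm_toR].
rewrite (_ : (\int[mu]_x _) = \int[mu]_x (f (BB x) - f (AA x))).
  rewrite bm_intB; try exact: bm_comp.
  have inv T : (forall A, measurable A -> mu (T @^-1` A) = mu A) -> measurable_fun setT T ->
      \int[mu]_x f (T x) = \int[mu]_x f x.
    by move=> muT mT; exact: bm_int_invariant.
  rewrite !inv ?subrr// => A mA.
    rewrite -[LHS]/(mu (T_ beta @^-1` (T_ b @^-1` A))) mu_beta ?mu_b//.
    by apply: measurable_preimage => //; exact: measurable_T.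
  rewrite -[LHS]/(mu (T_ b @^-1` (T_ beta @^-1` A))) mu_b ?mu_beta//.
  by apply: measurable_preimage => //; exact: measurable_T.
apply: eq_Rintegral => x _; rewrite -sumrB.
have [n jn nJ] := jump_nat x.
pose g i := fracpart (w i x - t).
transitivity (\sum_(i < J) if i%:R < n%:R :> R then g i.+1 - g i else 0).
  apply: eq_bigr => i _; rewrite /term jn; case: ifP => _; last by rewrite subrr.
  by congr (_ - _); rewrite /g /w -natr1; congr fracpart; ring.
rewrite telescope_lt// /g /f /w mul0r subr0; congr (_ - _).
have [k kE] := commutator x; apply: (@frac_eq _ _ _ (- k)).
by rewrite intrN -kE jn; ring.
Qed.

(** As a function of t, each active summand has slope -1 between upward jumps, so [J] times the
    total mass is a one-sided Lipschitz constant. *)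
Let H_const s t : H s = H t.
Proof.
apply: (@rotation_invariant_const _ H (q%:R * beta) (J%:R * fine (mu setT))) => //.
- move=> [r _ /esym qr]; apply: beta_irr; exists (r / q%:R) => //.
  by rewrite fmorph_div/= ratr_nat -qr mulrAC divff ?mul1r// gt_eqF.
- by rewrite mulr_ge0// fine_ge0.
move=> {}s {}t st.
have -> : J%:R * fine (mu setT) * (t - s) = \int[mu]_x (J%:R * (t - s)).
  by rewrite Rintegral_cst//; ring.
rewrite /H -bm_intB; [|exact: bm_sum|exact: bm_cst].
apply: bm_int_le; [|exact: bm_sum|].
  by apply: bmB; [exact: bm_sum|exact: bm_cst].
move=> x; rewrite mulr_natl -[J in _ *+ J]card_ord -sumr_const -sumrB.
apply: ler_sum => i _; rewrite /term; case: ifP => _; first exact: frac_shift_ge.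
by rewrite sub0r oppr_le0 subr_ge0.
Qed.

Let toXw (i : nat) (x : X R) : X R := toX (w i x).

Let measurable_toXw i : measurable_fun setT (toXw i).
Proof. by apply: measurable_toX; exact: (bm_frac (bm_w i).1).1. Qed.

Let active i : set (X R) := [set x | i%:R < jump x].

Let measurable_set_active i : measurable (active i).
Proof.
rewrite -[active i]setTI (_ : active i = (fun x => i%:R < jump x) @^-1` [set true])//.
exact: measurable_active.
Qed.

Let j0 : 0 <= \int[mu]_x jump x.
Proof. by apply: Rintegral_ge0 => x _; have [n -> _] := jump_nat x. Qed.

Let rho (i : nat) : {measure set (X R) -> \bar R} :=
  pushm (mrestr mu (measurable_set_active i)) (measurable_toXw i).

(** Expanding [H 0 = H t] with [frac_shiftE] gives the mass of [0, t) under the sum of the layers as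
    t times the integral of [jump], since [jump x] counts the layers active at x. *)
Let sum_rho A : measurable A ->
  (\sum_(i < J) rho i A = (\int[mu]_x jump x)%:E * lambda A)%E.
Proof.
pose m1 : {measure set (X R) -> \bar R} := msum rho J.
pose m2 : {measure set (X R) -> \bar R} := mscale (NngNum j0) (@lambda R).
have mr i (B : set (X R)) : measurable B -> measurable (toXw i @^-1` B `&` active i).
  by move=> mB; apply: measurableI => //; exact: measurable_preimage.
move=> mA; rewrite -[LHS]/(m1 A) -[RHS]/(m2 A).
apply: cdf_unique => // [|t t01].
  rewrite /m1/= /msum ltey_eq sum_fin_num; apply/orP; left; apply/allP => _ /mapP[i _ ->].
  by apply: (fin_num_measure mu); exact: mr.
rewrite /m1/= /msum /m2/= /mscale/= lambda_below// -EFinM.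
pose ind i : X R -> R := \1_(toXw i @^-1` below t `&` active i).
have bind i : bm (ind i).
  split; first by apply: measurable_indic; apply: mr; exact: measurable_below.
  by exists 1 => x; rewrite /ind indicE ger0_norm ?ler0n// lern1 leq_b1.
have -> : (\int[mu]_x jump x) * t = \sum_(i < J) \int[mu]_x ind i x.
  rewrite -(bm_int_sum mu J bind) mulrC -bm_intZ//.
  have H0t := H_const 0 t.
  apply/eqP; rewrite -subr_eq0 -bm_intB; last 2 first.
  - by apply: bmM => //; exact: bm_cst.
  - exact: bm_sum.
  move/eqP: H0t; rewrite -subr_eq0 /H -bm_intB; try exact: bm_sum.
  congr (_ == _); apply: eq_Rintegral => x _; rewrite -sumrB.
  have [n jn nJ] := jump_nat x.
  have tj : t * jump x = \sum_(i < J) (if i%:R < jump x then t else 0).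
    rewrite jn; under eq_bigr do rewrite ltr_nat.
    rewrite -big_mkcond/= -(big_ord_widen _ (fun=> t))//.
    by rewrite sumr_const card_ord mulr_natr.
  rewrite tj -sumrB; apply: eq_bigr => i _.
  rewrite /term /ind indicE in_setI subr0.
  have -> : (x \in active i) = (i%:R < jump x).
    by apply/idP/idP; rewrite inE.
  case: ifP => _; last by rewrite andbF subrr.
  rewrite andbT frac_shiftE//.
  have -> : (x \in toXw i @^-1` below t) = (fracpart (w i x) < t).
    by apply/idP/idP; rewrite inE.
  by ring.
rewrite -sumEFin; apply: eq_bigr => i _.
rewrite bm_int_indicator ?fineK ?fin_num_measure//; apply: mr; exact: measurable_below.
Qed.

(** When [mu] lives on the null set [N], layer 0 lives on the null set [E]; being dominated by a
    multiple of Lebesgue measure, it is 0. So [jump] vanishes almost everywhere, and with its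
    integral the mean of [mu]. *)
Lemma joint_invariant_singular N : measurable N -> lambda N = 0%E ->
  mu (~` N) = 0%E -> mu (~` [set X0 R]) = 0%E.
Proof.
move=> mN N0 muN.
pose psi (i : nat) (y : X R) : X R := toX ((toR y + i%:R) / q%:R).
have mpsi i : measurable_fun setT (psi i).
  apply: measurable_toX; apply: (@bm_frac _ _ _).1; apply: measurable_funM => //.
  by apply: measurable_funD => //; exact: measurable_toR.
(* The image of [N] under multiplication by q modulo 1, written with inverse branches so that it is
   visibly measurable. *)
pose E := \bigcup_(i in [set i | (i < q)%N]) (psi i @^-1` N).
have mE : measurable E by apply: bigcup_measurable => i _; exact: measurable_preimage.
have E0 : lambda E = 0%E.
  apply/eqP; rewrite -measure_le0.
  apply: (le_trans (@measure_sigma_subadditive _ _ _ (@lambda R) E (fun i => if (i < q)%N then psi i @^-1` N else set0) _ _ _)).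
  - by move=> i; case: ifP => // _; exact: measurable_preimage.
  - exact: mE.
  - by move=> x [i iq Nx]; exists i => //; rewrite iq.
  rewrite eseries0// => i _ _; case: ifP => iq; last by rewrite measure0.
  exact: (lambda_affine_preimage0 iq mN N0).
have mActive := measurable_set_active 0.
have rhoE0 : mu (toXw 0 @^-1` E `&` active 0) = 0%E.
  apply/le_anti; rewrite measure_ge0 andbT.
  have <- : (\sum_(i < J) rho i E = 0)%E by rewrite sum_rho// E0 mule0.
  by rewrite /J big_ord_recl leeDl// sume_ge0.
have active0 : mu (active 0) = 0%E.
  have mEa : measurable (toXw 0 @^-1` E `&` active 0).
    by apply: measurableI => //; exact: measurable_preimage.
  have mNA : measurable (AA @^-1` (~` N)).
    by apply: measurable_preimage => //; exact: measurableC.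
  apply: (@subset_measure0 _ _ _ mu _ ((toXw 0 @^-1` E `&` active 0) `|` AA @^-1` (~` N))) => //.
  - exact: measurableU.
  - move=> x ax; have [Nx|Nx] := pselect (N (AA x)); [left|by right].
    split => //; rewrite /preimage/=.
    have f0 : 0 <= Num.floor (q%:R * toR (AA x)).
      by rewrite floor_ge0 mulr_ge0// toR_ge0.
    have [i iE] : exists i : nat, Num.floor (q%:R * toR (AA x)) = i.
      by case: (Num.floor _) f0 => // i _; exists i.
    exists i => /=.
      rewrite -(ltr_nat R) (pmulrn _ i) -iE (le_lt_trans (floor_le _))//.
      by rewrite gtr_pMr// toR_lt1.
    rewrite /preimage/= (_ : psi i _ = AA x)//; apply: toR_inj.
    suff : fracpart ((fracpart (q%:R * toR (AA x) - 0%:R * (q%:R * beta)) + i%:R) / q%:R) = toR (AA x) by [].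
    rewrite mul0r subr0 /fracpart iE -pmulrn subrK mulrAC divff ?gt_eqF// mul1r.
    by rewrite -/(fracpart _) frac_id// toR_ge0 toR_lt1.
  - apply/eqP; rewrite -measure_le0; apply: (le_trans (measureU2 _ mEa mNA)).
    suff AN0 : mu (AA @^-1` (~` N)) = 0%E.
      by rewrite [X in (X + _)%E]rhoE0 add0e [leLHS]AN0.
    rewrite -[LHS]/(mu (T_ beta @^-1` (T_ b @^-1` (~` N)))) mu_beta ?mu_b ?muN//.
      exact: measurableC.
    by apply: measurable_preimage; [exact: measurable_T|exact: measurableC].
have int_jump : \int[mu]_x jump x <= 0.
  have bact : bm (\1_(active 0) : X R -> R).
    split; first exact: measurable_indic.
    by exists 1 => x; rewrite indicE ger0_norm ?ler0n// lern1 leq_b1.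
  have -> : 0 = \int[mu]_x (J%:R * \1_(active 0) x).
    by rewrite bm_intZ// bm_int_indicator// active0 mulr0.
  apply: bm_int_le => //; first by apply: bmM => //; exact: bm_cst.
  move=> x; have [n jn nJ] := jump_nat x; rewrite indicE.
  case: n jn nJ => [-> _|n jn nJ]; first by rewrite mulr_ge0// ler0n.
  have -> : x \in active 0 by rewrite inE -[active 0 x]/(0 < jump x : Prop) jn ltr0n.
  by rewrite mulr1 jn ler_nat.
have int_toR : \int[mu]_x toR x <= 0.
  have := int_jump; rewrite /jump bm_intB; last 2 first.
  - apply: bmD; last by apply: bm_comp; [exact: measurable_T|exact: bm_toR].
    by apply: bmM; [exact: bm_cst|exact: bm_toR].
  - by apply: bm_comp; [exact: measurable_T|exact: bm_toR].
  rewrite bm_intD; last 2 first.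
  - by apply: bmM; [exact: bm_cst|exact: bm_toR].
  - by apply: bm_comp; [exact: measurable_T|exact: bm_toR].
  rewrite bm_intZ; last exact: bm_toR.
  rewrite (bm_int_invariant (measurable_T beta) mu_beta (@bm_toR R)).
  rewrite (bm_int_invariant (measurable_T b) mu_b (@bm_toR R)).
  by rewrite addrK pmulr_rle0.
have -> : ~` [set X0 R] = \bigcup_(n : nat) ~` (below n.+1%:R^-1).
  apply/seteqP; split => x /=.
    move=> x0; have {}x0 : 0 < toR x.
      rewrite lt_neqAle toR_ge0 andbT eq_sym; apply/eqP => x0'; apply: x0.
      by apply: toR_inj; rewrite x0'.
    exists (Num.truncn (toR x)^-1) => //=; apply/negP; rewrite -leNgt.
    by rewrite ltW// invf_plt ?posrE// truncnS_gt.
  move=> [n _ /= xn] x0; apply: xn.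
  by rewrite x0 /below/= invr_gt0.
have mC n : measurable (~` (below (n.+1%:R^-1 : R))).
  by apply: measurableC; exact: measurable_below.
apply/eqP; rewrite -measure_le0.
apply: (le_trans (measure_sigma_subadditive mu mC (bigcupT_measurable _ mC) (@subset_refl _ _))).
rewrite eseries0// => n _ _.
rewrite -[LHS]fineK ?fin_num_measure//; congr EFin; apply/le_anti.
rewrite fine_ge0// andbT -bm_int_indicator//.
have bn : bm (\1_(~` (below (n.+1%:R^-1 : R))) : X R -> R).
  split; first exact: measurable_indic.
  by exists 1 => x; rewrite indicE ger0_norm ?ler0n// lern1 leq_b1.
(* Markov's inequality. *)
apply: (@le_trans _ _ (\int[mu]_x (n.+1%:R * toR x))).
  apply: bm_int_le => //; first by apply: bmM; [exact: bm_cst|exact: bm_toR].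
  move=> x; rewrite indicE; case: (boolP (x \in _)) => [|_]; last by rewrite mulr_ge0// toR_ge0.
  by rewrite inE /= => /negP; rewrite -leNgt -ler_pdivrMl// mulr1.
by rewrite bm_intZ; [rewrite pmulr_rle0|exact: bm_toR].
Qed.

End rotation_trick.

(** * Arithmetic of the orbit of 1 *)

Section kinks.
Context {R : realType}.
Implicit Types (t x e : R).

Lemma le_geometric (q a B E : R) (N0 : nat) : 0 <= q < 1 ->
  (forall n, (N0 <= n)%N -> a <= B + E * q ^+ n) -> a <= B.
Proof.
move=> /andP[q0 q1] aq.
have c : B + E * q ^+ n @[n --> \oo] --> B + E * 0.
  by apply: cvgD; [exact: cvg_cst|apply: cvgMr; apply: cvg_expr; rewrite ger0_norm].
rewrite -[leRHS]addr0 -(mulr0 E) -(cvg_lim _ c)//.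
by apply: limr_ge; [exact: cvgP c|near=> n; apply: aq; near: n; exact: nbhs_infty_ge].
Unshelve. all: by end_near. Qed.

Lemma isolated (l : seq R) t : exists2 e, 0 < e &
  forall s, s \in l -> s != t -> e <= `|s - t|.
Proof.
elim: l => [|s l [e e0 el]]; first by exists 1.
have [->|st] := eqVneq s t.
  by exists e => // s'; rewrite inE => /predU1P[->|/el//]; rewrite eqxx.
exists (Num.min e `|s - t|); first by rewrite lt_min e0 normr_gt0 subr_eq0.
by move=> s'; rewrite inE ge_min => /predU1P[->|/el h /h ->]; rewrite ?lexx ?orbT.
Qed.

(** Minus the second difference of x -> min(s, x) at [t]: the slope drops from 1 to 0 at [s], and
    the function is affine on the window when [s] is elsewhere. *)
Lemma min_kink (s t e : R) : 0 < e -> (s != t -> e <= `|s - t|) ->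
  2 * Num.min s t - Num.min s (t - e) - Num.min s (t + e) =
  e * (s == t)%:R.
Proof.
move=> e0; have [->|st /(_ isT)] := eqVneq s t.
  move=> _; rewrite minxx (@min_r _ _ t (t - e)) ?gerBl ?(ltW e0)//.
  by rewrite min_l ?lerDl ?(ltW e0)//= mulr1; ring.
rewrite mulr0; have [{}st|{}st] := ltP s t.
  rewrite ltr0_norm ?subr_lt0// => h.
  by rewrite !min_l; [ring|lra|lra].
rewrite ger0_norm ?subr_ge0// => h.
by rewrite !min_r; [ring|lra|lra].
Qed.

(** Second differences at [t] kill the linear terms. The step does not exceed the distance from [t]
    to any other breakpoint or to 0 and 1, so only kinks at [t] itself remain. *)
Lemma kink_sum (m : nat) (b : R) (a k s u : nat -> R) t : 0 < t < 1 ->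
  (forall x, 0 <= x <= 1 ->
    \sum_(i < m) a i * (b * Num.min (s i) x - k i * x - Num.min (u i) x) = 0) ->
  b * \sum_(i < m) a i * (s i == t)%:R = \sum_(i < m) a i * (u i == t)%:R.
Proof.
move=> /andP[t0 t1] sum0.
have [e' e'0 e'l] := isolated (map s (iota 0 m) ++ map u (iota 0 m)) t.
pose e := Num.min e' (Num.min t (1 - t)).
have e0 : 0 < e by rewrite !lt_min e'0 t0 subr_gt0.
have ee' : e <= e' by rewrite ge_min lexx.
have et : e <= t by rewrite !ge_min lexx orbT.
have et1 : e <= 1 - t by rewrite !ge_min lexx !orbT.
have sk (i : 'I_m) : s i != t -> e <= `|s i - t|.
  move=> si; apply: le_trans ee' _; apply: e'l => //.
  by rewrite mem_cat map_f// mem_iota/= add0n.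
have uk (i : 'I_m) : u i != t -> e <= `|u i - t|.
  move=> ui; apply: le_trans ee' _; apply: e'l => //.
  by rewrite mem_cat [X in _ || X]map_f ?orbT// mem_iota/= add0n.
have x1 : 0 <= t <= 1 by rewrite !ltW.
have x2 : 0 <= t - e <= 1 by apply/andP; split; lra.
have x3 : 0 <= t + e <= 1 by apply/andP; split; lra.
apply/eqP; rewrite -subr_eq0 -(mulrI_eq0 _ (lregP (lt0r_neq0 e0))); apply/eqP.
transitivity (2 * 0 - 0 - 0 : R); last by ring.
rewrite -[X in _ = 2 * X - _ - _](sum0 _ x1) -[X in _ = _ - X - _](sum0 _ x2).
rewrite -[X in _ = _ - _ - X](sum0 _ x3).
rewrite mulrBr !mulr_sumr -!sumrB; apply: eq_bigr => i _.
have := min_kink e0 (sk i); have := min_kink e0 (uk i).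
move: (Num.min (s i) _) (Num.min (s i) (t - e)) (Num.min (s i) (t + e)) => s1 s2 s3.
move: (Num.min (u i) _) (Num.min (u i) (t - e)) (Num.min (u i) (t + e)) => u1 u2 u3.
move=> hu hs.
transitivity (b * a i * (e * (s i == t)%:R) - a i * (e * (u i == t)%:R)); first by ring.
by rewrite -hs -hu; ring.
Qed.

End kinks.

Section orbit_of_one.
Context {R : realType}.
Variables (beta b : R).
Hypotheses (beta_gt1 : 1 < beta) (beta_b : beta < b).

(** Lives in R because its starting point 1 is outside [0, 1). *)
Definition orbit1 (n : nat) : R := iter n (fun s => fracpart (beta * s)) 1.
Local Notation t := orbit1.
Local Notation r := (beta^-1).

Let beta0 : 0 < beta. Proof. exact: lt_trans beta_gt1. Qed.
Let b0 : 0 < b. Proof. exact: lt_trans beta_b. Qed.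
Let r0 : 0 < r. Proof. by rewrite invr_gt0. Qed.
Let r1 : r < 1. Proof. by rewrite invf_lt1. Qed.
Let r01 : 0 <= r < 1. Proof. by rewrite r1 (ltW r0). Qed.
Let rn0 n : 0 < r ^+ n. Proof. by rewrite exprn_gt0. Qed.

Lemma orbit1S n : t n.+1 = fracpart (beta * t n). Proof. by []. Qed.

Lemma orbit1_ge0 n : 0 <= t n.
Proof. by case: n => [|n]; [exact: ler01|exact: frac_ge0]. Qed.

Lemma orbit1_lt1 n : t n.+1 < 1.
Proof. exact: frac_lt1. Qed.

Lemma orbit1_le1 n : t n <= 1.
Proof. by case: n => [|n]; [exact: lexx|exact: ltW (orbit1_lt1 n)]. Qed.

Lemma geometric_sum n : (1 - r) * \sum_(i < n) r ^+ i = 1 - r ^+ n.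
Proof. by rewrite -opprB mulNr -subrX1 opprB. Qed.

Let s n := fracpart (b * t n).
Let k n : R := (Num.floor (b * t n))%:~R.
Let k0 n : 0 <= k n.
Proof. by rewrite ler0z floor_ge0 mulr_ge0 ?orbit1_ge0// ltW. Qed.

(** The condition below is T_b-invariance of the distribution function with terms r^n min(t n, x),
    truncated after N terms: T_b spreads [0, t n) over [k n] full copies of the space and one copy
    of [0, s n). The right side pays for the tails. *)
Variable C : R.
Hypothesis almost : forall N x, 0 <= x <= 1 ->
  `|\sum_(n < N) r ^+ n * (b * Num.min (t n) x - k n * x - Num.min (s n) x)|
    <= C * r ^+ N.

Let C0 : 0 <= C.
Proof.
have o01 : 0 <= (0 : R) <= 1 by rewrite lexx ler01.
by have := almost 0 o01; rewrite big_ord0 normr0 expr0 mulr1.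
Qed.

Let D := (1 - r)^-1.
Let D0 : 0 < D. Proof. by rewrite invr_gt0 subr_gt0. Qed.
Let geom_le n : \sum_(i < n) r ^+ i <= D.
Proof.
have : (1 - r) * \sum_(i < n) r ^+ i <= 1 by rewrite geometric_sum gerBl ltW.
by rewrite -ler_pdivlMl ?subr_gt0// mulr1.
Qed.

Let max_orbit L : exists2 x, 0 <= x < 1 & forall n, (n < L)%N -> t n.+1 <= x.
Proof.
elim: L => [|L [x /andP[x0 x1] xL]]; first by exists 0; rewrite ?lexx ?ltr01.
exists (Num.max x (t L.+1)).
  by rewrite le_max x0/= gt_max x1 orbit1_lt1.
by move=> n; rewrite ltnS leq_eqVlt le_max => /predU1P[->|/xL ->//]; rewrite lexx orbT.
Qed.

Let min_orbit L : (forall n, 0 < t n) ->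
  exists2 x, 0 < x <= 1 & forall n, (n < L)%N -> x <= t n.
Proof.
move=> t0; elim: L => [|L [x /andP[x0 x1] xL]]; first by exists 1; rewrite ?lexx ?ltr01.
exists (Num.min x (t L)).
  by rewrite lt_min x0 t0/= ge_min x1.
by move=> n; rewrite ltnS leq_eqVlt ge_min => /predU1P[->|/xL ->//]; rewrite lexx orbT.
Qed.

(* The slope at [1] of the cumulative distribution function: only the term
   [n = 0] of the density reaches up to [1]. *)
Let slope1 N : \sum_(n < N) r ^+ n * k n <= b.
Proof.
(* Two limits: for fixed [L], take x at or above t 1, ..., t L, so that among the terms up to [L]
   only term 0 still grows between x and 1; let M grow with x fixed, and then L. *)
apply: (@le_geometric R r _ _ (b * D) 0 r01) => L _.
have [x /andP[x0 x1] xL] := max_orbit L.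
apply: (@le_geometric R r _ _ (2 * C / (1 - x)) (maxn N L.+1) r01) => M.
rewrite geq_max => /andP[NM LM].
have x1' : 0 < 1 - x by rewrite subr_gt0.
apply: (@le_trans _ _ (\sum_(n < M) r ^+ n * k n)).
  rewrite -(subnKC NM) big_split_ord/= lerDl; apply: sumr_ge0 => i _.
  by rewrite mulr_ge0// ltW.
rewrite -(ler_pM2r x1').
have x01 : 0 <= x <= 1 by rewrite x0 ltW.
have o01 : 0 <= (1 : R) <= 1 by rewrite ler01 lexx.
have := almost M x01; have := almost M o01; rewrite !ler_norml => /andP[h1 _] /andP[_ h2].
have h : (\sum_(n < M) r ^+ n * k n) * (1 - x) <=
   \sum_(n < M) r ^+ n * (b * (t n - Num.min (t n) x)) + 2 * C * r ^+ M.
  rewrite mulr_suml -lerBlDl -sumrB.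
  apply: (@le_trans _ _ (\sum_(n < M) (r ^+ n * (b * Num.min (t n) x - k n * x - Num.min (s n) x)
    - r ^+ n * (b * Num.min (t n) 1 - k n * 1 - Num.min (s n) 1)))).
    apply: ler_sum => n _; rewrite !(@min_l _ _ _ 1) ?orbit1_le1 ?(ltW (frac_lt1 _))//.
    have : r ^+ n * Num.min (s n) x <= r ^+ n * s n by rewrite ler_pM2l// ge_min lexx.
    by lra.
  by rewrite sumrB; lra.
apply: (le_trans h); rewrite [leRHS]mulrDl lerD//; last first.
  by rewrite [leRHS](_ : _ = 2 * C * r ^+ M)//; field; rewrite subr_eq0 gt_eqF// gt_eqF.
rewrite -(subnKC LM) big_split_ord/= big_ord_recl expr0 mul1r.
have -> : t 0 - Num.min (t 0) x = 1 - x by rewrite min_r// ltW.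
rewrite mulrDl -addrA lerD2l big1 ?add0r; last first.
  move=> i _; have -> : Num.min (t (lift ord0 i)) x = t (lift ord0 i) by apply/min_l/xL.
  by rewrite subrr !mulr0.
apply: (@le_trans _ _ (\sum_(i < M - L.+1) (r ^+ L * (b * (1 - x))) * r ^+ i)); last first.
  rewrite -mulr_sumr [leRHS](_ : _ = r ^+ L * (b * (1 - x)) * D); last by ring.
  by rewrite ler_wpM2l ?geom_le// !mulr_ge0 ?(ltW (rn0 _)) ?(ltW b0) ?(ltW x1').
apply: ler_sum => i _; rewrite mulrAC -exprD ler_pM//.
- exact: ltW (rn0 _).
- by rewrite mulr_ge0 ?(ltW b0)// subr_ge0 ge_min lexx.
- by rewrite addSn exprS ger_pMl// ltW.
- rewrite ler_pM2l// lerBlDr.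
  have := frac_lt1 (beta * t (L + i)); move: (fracpart _) => v v1.
  by have [vx|xv] := leP v x; move: x1' v1; lra.
Qed.

(** If the orbit never met 0, the distribution function would have slope D = beta / (beta - 1) at 0.
    The invariance equation then bounds b D by the sum of the r^n k n, at most b by [slope1], plus
    D. But b D <= b + D amounts to b <= beta. *)
Lemma orbit1_finite : exists N, t N = 0.
Proof.
apply: contrapT => /forallNP tN0.
have t0 n : 0 < t n by rewrite lt_neqAle orbit1_ge0 eq_sym andbT; exact/eqP.
have bD L : b * \sum_(i < L) r ^+ i <= b + D.
  have [x /andP[x0 x1] xL] := min_orbit L t0.
  apply: (@le_geometric R r _ _ (C / x) L r01) => M LM.
  have x01 : 0 <= x <= 1 by rewrite (ltW x0).
  rewrite -(ler_pM2r x0).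
  have := almost M x01; rewrite ler_norml => /andP[_ h].
  have lo : (b * \sum_(i < L) r ^+ i) * x <= \sum_(n < M) r ^+ n * (b * Num.min (t n) x).
    rewrite -(subnKC LM) big_split_ord/= -mulrA mulr_suml mulr_sumr -[leLHS]addr0 lerD//.
      apply: ler_sum => i _; rewrite min_r ?xL//.
      by rewrite mulrCA.
    apply: sumr_ge0 => i _; rewrite !mulr_ge0 ?(ltW (rn0 _)) ?(ltW b0)//.
    by rewrite le_min orbit1_ge0 ltW.
  have hi : \sum_(n < M) r ^+ n * (k n * x + Num.min (s n) x) <= (b + D) * x.
    apply: (@le_trans _ _ ((\sum_(n < M) r ^+ n * k n + \sum_(n < M) r ^+ n) * x)); last first.
      by rewrite ler_pM2r// lerD.
    rewrite mulrDl !mulr_suml -big_split/=; apply: ler_sum => n _.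
    rewrite mulrDr mulrA lerD2l ler_pM2l//.
    by rewrite ge_min lexx orbT.
  rewrite [leRHS](_ : _ = (b + D) * x + C * r ^+ M); last by field; rewrite gt_eqF.
  apply: (le_trans lo).
  apply: (@le_trans _ _ (\sum_(n < M) r ^+ n * (k n * x + Num.min (s n) x) + C * r ^+ M)).
    rewrite -lerBlDl -sumrB.
    apply: le_trans h; apply: ler_sum => n _.
    by rewrite -mulrBr opprD addrA.
  by rewrite lerD2r.
have bDD : b * D <= b + D.
  apply: (@le_geometric R r _ _ (b * D) 0 r01) => L _.
  rewrite -lerBlDr; apply: le_trans (bD L).
  have -> : \sum_(i < L) r ^+ i = D * (1 - r ^+ L).
    by rewrite -geometric_sum mulrA mulVf ?mul1r// gt_eqF// subr_gt0.
  by rewrite le_eqVlt; apply/orP; left; apply/eqP; ring.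
have n1 : beta - 1 != 0 by rewrite subr_eq0 gt_eqF.
have n2 : beta != 0 by rewrite gt_eqF.
have DE : D = beta / (beta - 1) by rewrite /D; field; rewrite n1 n2.
move: bDD; rewrite DE.
have : (b + beta / (beta - 1)) - b * (beta / (beta - 1)) = (beta - b) / (beta - 1).
  by field.
rewrite -subr_ge0 => ->; rewrite pmulr_lge0 ?invr_gt0 ?subr_gt0// subr_ge0.
by rewrite leNgt beta_b.
Qed.

Hypothesis t1_neq0 : t 1 != 0.

(* If the orbit dies after [M1 + 1] steps, the kinks of the distribution function
   at [t 1], ..., [t M1] express each [b * r ^+ j] as a sum of [r ^+ i] over
   disjoint nonempty sets of indices [i <= M1].  When [M1 >= 2] one of these sets
   is a singleton by counting, which makes [b] a power of [beta]. *)
Lemma orbit1_two_steps : b = beta + 1 /\ t 2 = 0.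
Proof.
have [N [tN minN]] : exists N, t N = 0 /\ forall n, t n = 0 -> (N <= n)%N.
  have exN : exists n, t n == 0 by have [N /eqP ?] := orbit1_finite; exists N.
  case: (ex_minnP exN) => N /eqP tN minN.
  by exists N; split => // n /eqP /minN.
case: N tN minN => [/eqP|[/eqP|M]]; rewrite ?oner_eq0// ?(negbTE t1_neq0)// => tM minM.
set M1 := M.+1 in tM minM *.
have t_pos n : (n <= M1)%N -> 0 < t n.
  move=> nM; rewrite lt_neqAle orbit1_ge0 andbT eq_sym; apply/eqP => /minM.
  by rewrite leqNgt ltnS nM.
have t_shift n p : t n = t p -> forall d, t (n + d) = t (p + d).
  by move=> np; elim=> [|d IH]; rewrite ?addn0// !addnS !orbit1S IH.
(* Equal points of the orbit would reach 0 after equally many further steps, against the minimality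
   of the extinction time. *)
have t_inj n p : (n <= M1)%N -> (p <= M1)%N -> t n = t p -> n = p.
  wlog np : n p / (n < p)%N.
    by move=> wl nM pM e; have [/wl|/wl|//] := ltngtP n p; [exact|move=> h; apply/esym/h].
  move=> nM pM np'; have pM' : (p <= M1.+1)%N by apply: leqW.
  have := t_shift _ _ np' (M1.+1 - p)%N; rewrite (subnKC pM') tM => /minM h.
  by exfalso; move: h; rewrite leqNgt -[X in (_ < X)%N](subnKC pM') ltn_add2r np.
(* The terms past [M1] vanish, so the finite sum obeys arbitrarily small bounds and is exactly 0. *)
have sum0 x : 0 <= x <= 1 ->
    \sum_(i < M1.+1) r ^+ i * (b * Num.min (t i) x - k i * x - Num.min (s i) x) = 0.
  move=> x01; apply/eqP; rewrite -normr_le0.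
  apply: (@le_geometric R r _ _ C M1.+1 r01) => n Mn; rewrite add0r.
  have := almost n x01; congr (`|_| <= _).
  have tz p : t (M1.+1 + p) = 0.
    elim: p => [|d IH]; first by rewrite addn0.
    by rewrite addnS orbit1S IH mulr0 /fracpart floor0 subr0.
  have z p : r ^+ (M1.+1 + p) * (b * Num.min (t (M1.+1 + p)) x -
      k (M1.+1 + p) * x - Num.min (s (M1.+1 + p)) x) = 0.
    have -> : s (M1.+1 + p) = 0 by rewrite /s tz mulr0 /fracpart floor0 subr0.
    have -> : k (M1.+1 + p) = 0 by rewrite /k tz mulr0 floor0.
    by rewrite tz min_l; [ring|case/andP: x01].
  rewrite (big_ord_widen n (fun i => r ^+ i * (b * Num.min (t i) x - k i * x - Num.min (s i) x)) Mn).
  rewrite [RHS]big_mkcond/=; apply: eq_bigr => i _; case: ltnP => // Mi.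
  by rewrite -(subnKC Mi) z.
have tk (j : 'I_M1) : b * r ^+ j.+1 = \sum_(i < M1.+1) r ^+ i * (s i == t j.+1)%:R.
  have tj01 : 0 < t j.+1 < 1 by rewrite orbit1_lt1 t_pos.
  rewrite -(kink_sum tj01 sum0); congr (b * _).
  have jM : (j.+1 < M1.+1)%N by rewrite ltnS ltn_ord.
  rewrite (bigD1 (Ordinal jM))//= eqxx mulr1 big1 ?addr0// => i ij.
  case: eqP => [e|]; last by rewrite mulr0.
  exfalso; move/eqP: ij; apply; apply/val_inj.
  exact: (t_inj i j.+1 (leq_ord i) (ltn_ord j) e).
have disj (i : 'I_M1.+1) : \sum_(j < M1) (s i == t j.+1)%:R <= 1 :> R.
  have [[j sj]|nj] := pselect (exists j : 'I_M1, s i = t j.+1).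
    rewrite (bigD1 j)//= sj eqxx big1 ?addr0// => l lj.
    case: eqP => [e|//]; exfalso; move/eqP: lj; apply; apply/val_inj.
    by have [] := t_inj _ _ (ltn_ord j : (j.+1 <= M1)%N) (ltn_ord l) e.
  rewrite big1// => j _; case: eqP => [e|//]; exfalso; apply: nj; by exists j.
have sumb : b * \sum_(j < M1) r ^+ j.+1 <= \sum_(i < M1.+1) r ^+ i.
  rewrite mulr_sumr (eq_bigr _ (fun j _ => tk j)) exchange_big/=.
  by apply: ler_sum => i _; rewrite -mulr_sumr ger_pMr.
(* With a single kink, [tk] multiplied by beta writes b as beta times a truth value plus another
   truth value; b > beta > 1 forces both to be true. *)
have [M0|M_gt0] := posnP M.
  rewrite /M1 M0 in tk tM *.
  split; last exact: tM.
  have := tk ord0; rewrite !big_ord_recl big_ord0 expr0 expr1 addr0 !mul1r.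
  have n2 : beta != 0 by rewrite gt_eqF.
  move=> /(congr1 (fun y => y * beta)); rewrite mulfVK// mulrDl mulrAC mulVf// mul1r.
  have := beta_b; have := beta_gt1.
  by case: (_ == _); case: (_ == _); rewrite /= ?mul1r ?mul0r; lra.
exfalso.
(* Otherwise each of the [M1] kinks takes at least two of the [M1.+1] indices, impossible for M1 >=
   2. *)
have [j [i bji]] : exists (j : 'I_M1) (i : 'I_M1.+1), b * r ^+ j.+1 = r ^+ i.
  apply: contrapT => no.
  have two (j : 'I_M1) : 2 <= \sum_(i < M1.+1) (s i == t j.+1)%:R :> R.
    have [[i si]|ni] := pselect (exists i : 'I_M1.+1, s i = t j.+1); last first.
      have := tk j; rewrite big1; last first.
        by move=> i _; case: eqP => [e|]; rewrite ?mulr0//; exfalso; apply: ni; exists i.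
      by move/eqP; rewrite gt_eqF// mulr_gt0.
    have [[l /andP[li sl]]|nl] := pselect (exists l : 'I_M1.+1, (l != i) && (s l == t j.+1)).
      rewrite (bigD1 i)//= (bigD1 l)//= si eqxx sl addrA lerDl.
      by apply: sumr_ge0 => ? _; exact: ler0n.
    exfalso; apply: no; exists j, i; rewrite tk (bigD1 i)//= si eqxx mulr1 big1 ?addr0// => l li.
    case: eqP => [/eqP e|]; rewrite ?mulr0//; exfalso; apply: nl; exists l.
    by rewrite li e.
  have : \sum_(j < M1) 2 <= \sum_(i < M1.+1) 1 :> R.
    apply: (@le_trans _ _ (\sum_(j < M1) \sum_(i < M1.+1) (s i == t j.+1)%:R)).
      by apply: ler_sum => j _; exact: two.
    by rewrite exchange_big/=; apply: ler_sum => i _; exact: disj.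
  rewrite !sumr_const !card_ord -mulrnA ler_nat /M1; lia.
have bj : b = beta ^+ j.+1 / beta ^+ i.
  by rewrite -exprVn -bji exprVn mulrCA divff ?mulr1// gt_eqF// exprn_gt0.
(* Since b is the power j + 1 - i of beta and exceeds beta, the exponent is at least 2. *)
have ij : (i.+2 <= j.+1)%N.
  rewrite leqNgt; apply/negP => ij; move: beta_b; rewrite bj.
  rewrite ltr_pdivlMr ?exprn_gt0// -exprS; apply/negP; rewrite -leNgt.
  by rewrite ler_eXn2l.
have b2 : beta ^+ 2 <= b.
  by rewrite bj ler_pdivlMr ?exprn_gt0// -exprD add2n ler_eXn2l.
pose S := \sum_(j < M1) r ^+ j.+1; pose P := beta ^+ M1.
have P0 : 0 < P by rewrite exprn_gt0.
have S0 : 0 <= S by apply: sumr_ge0 => l _; exact: ltW (rn0 _).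
have S1 : \sum_(i < M1.+1) r ^+ i = 1 + S by rewrite big_ord_recl.
have bS : beta ^+ 2 * S <= 1 + S.
  by rewrite -S1; apply: le_trans sumb; rewrite ler_wpM2r.
have SE : (beta - 1) * S = 1 - P^-1.
  have := geometric_sum M1.+1; rewrite S1 exprS /P -exprVn => h.
  have n2 : beta != 0 by rewrite gt_eqF.
  have -> : (beta - 1) * S = beta * ((1 - r) * (1 + S)) - (beta - 1) by field.
  by rewrite h; field.
(* The contradiction: b >= beta^2 in [sumb] gives beta P <= beta + 1, while the positive integer
   beta * t M1 is at most P (beta - 1). Together they yield P <= beta, against P >= beta^2. *)
have upper : beta * P <= beta + 1.
  have : (beta + 1) * ((beta - 1) * S) <= 1 by lra.
  rewrite SE -(ler_pM2r P0) mul1r mulrBr mulr1 mulrBl -mulrA mulVf ?gt_eqF//.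
  by lra.
have t_le n : t n.+1 <= beta ^+ n * (beta - 1).
  elim: n => [|n IH].
    rewrite expr0 mul1r orbit1S mulr1 /fracpart lerD2l lerN2 -[1]/(1%:~R) ler_int.
    by rewrite floor_ge_int ltW.
  rewrite orbit1S; apply: (@le_trans _ _ (beta * t n.+1)).
    rewrite /fracpart gerBl ler0z floor_ge0; apply: mulr_ge0; [exact: ltW|exact: orbit1_ge0].
  by rewrite exprS -mulrA ler_pM2l.
have lower : 1 <= P * (beta - 1).
  apply: (@le_trans _ _ (beta * t M1)); last first.
    by rewrite /P exprS -mulrA ler_pM2l//; exact: t_le.
  have fl : beta * t M1 = (Num.floor (beta * t M1))%:~R.
    by apply/eqP; rewrite -subr_eq0; apply/eqP; exact: tM.
  have : 0 < beta * t M1 by rewrite mulr_gt0// t_pos.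
  by rewrite fl ltr0z -[1 in X in _ -> X]/(1%:~R) ler_int gtz0_ge1.
have : beta ^+ 2 <= P by rewrite ler_eXn2l.
have : beta < beta ^+ 2 by rewrite expr2 ltr_pMl.
by lra.
Qed.

End orbit_of_one.

Lemma coincidence_exceptional (R : realType) (beta : R) (c : rat) (C : R) :
  1 < beta -> irrational beta -> 0 < c ->
  let b := beta + ratr c in
  (forall N x, 0 <= x <= 1 ->
    `|\sum_(n < N) beta^-1 ^+ n * (b * Num.min (orbit1 beta n) x -
        (Num.floor (b * orbit1 beta n))%:~R * x -
        Num.min (fracpart (b * orbit1 beta n)) x)| <= C * beta^-1 ^+ N) ->
  exceptional beta c.
Proof.
move=> beta1 irr c0 b almost.
have beta_b : beta < b by rewrite /b ltrDl ltr0q.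
have t1 : orbit1 beta 1 != 0.
  apply/eqP; rewrite orbit1S mulr1 /fracpart => /subr0_eq e.
  by apply: irr; exists (Num.floor beta)%:~R => //; rewrite ratr_int.
have [bE t2] := orbit1_two_steps beta1 beta_b almost t1.
have c1 : c = 1.
  apply: (@fmorph_inj _ R ratr); rewrite rmorph1.
  by move: bE; rewrite /b => /addrI.
split => //; split => //.
have u1 : 1 <= Num.floor beta by rewrite floor_ge_int ltW.
have v1 : 1 <= Num.floor (beta * orbit1 beta 1).
  rewrite -gtz0_ge1 -(ltr0z R).
  have : 0 < beta * orbit1 beta 1.
    apply: mulr_gt0; first exact: lt_trans ltr01 beta1.
    by rewrite lt_neqAle eq_sym t1 orbit1_ge0.
  by move: t2; rewrite orbit1S {1}/fracpart => /subr0_eq <-.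
have [u uE] : exists u : nat, Num.floor beta = u.
  by case: (Num.floor beta) u1 => // u _; exists u.
have [v vE] : exists v : nat, Num.floor (beta * orbit1 beta 1) = v.
  by case: (Num.floor _) v1 => // v _; exists v.
have t1E : orbit1 beta 1 = beta - u%:R.
  by rewrite orbit1S mulr1 /fracpart uE -pmulrn.
have t2E : beta * orbit1 beta 1 = v%:R.
  by move: t2; rewrite orbit1S {1}/fracpart vE => /subr0_eq; rewrite -pmulrn.
exists u, v; split; last first.
  by rewrite -t2E t1E; ring.
apply/andP; split; first by rewrite -lez_nat -vE.
(* v = beta * t 1 < beta < u + 1. *)
rewrite -ltnS -(ltr_nat R) -t2E; apply: (@lt_trans _ _ beta).
  by rewrite gtr_pMr ?(lt_trans ltr01)// orbit1_lt1.
by rewrite -natr1 (pmulrn _ u) -uE -intrD1 floorD1_gt.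
Qed.

(** * Parry's measure *)

Section parry_measure.
Context {R : realType}.
Variable beta : R.
Hypothesis beta_gt1 : 1 < beta.
Local Notation t := (orbit1 beta).
Local Notation r := (beta^-1).

Let beta0 : 0 < beta. Proof. exact: lt_trans beta_gt1. Qed.
Let r0 : 0 < r. Proof. by rewrite invr_gt0. Qed.
Let r1 : r < 1. Proof. by rewrite invf_lt1. Qed.
Let rn0 n : 0 < r ^+ n. Proof. by rewrite exprn_gt0. Qed.
Let t01 n : 0 <= t n <= 1. Proof. by rewrite orbit1_ge0 orbit1_le1. Qed.

Let term (n : nat) : {measure set (X R) -> \bar R} :=
  mscale (NngNum (ltW (rn0 n))) (mrestr (@lambda R) (measurable_below (t n))).

(** The measure whose density is the sum over n of r^n times the indicator of [0, t n), left
    unnormalised since it is compared only up to a factor. *)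
Definition parry : set (X R) -> \bar R := mseries term 0.
HB.instance Definition _ := Measure.on parry.

Let w n (A : set (X R)) : R := r ^+ n * fine (lambda (below (t n) `&` A)).

Let mI n A : measurable A -> measurable (below (t n) `&` A).
Proof. by move=> mA; apply: measurableI => //; exact: measurable_below. Qed.

Let termE n A : measurable A -> term n A = (w n A)%:E.
Proof.
move=> mA; rewrite /term/= /mscale/= /mrestr setIC /w EFinM fineK//.
by apply: lambda_fin; exact: mI.
Qed.

Let w_ge0 n A : 0 <= w n A.
Proof. by rewrite mulr_ge0 ?(ltW (rn0 _))// fine_ge0. Qed.

Let w_le n A : measurable A -> w n A <= r ^+ n.
Proof.
move=> mA; rewrite ler_piMr ?(ltW (rn0 _))// -lee_fin fineK ?lambda_fin//; try exact: mI.
by apply: probability_le1; exact: mI.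
Qed.

Let D := (1 - r)^-1.
Let D0 : 0 < D. Proof. by rewrite invr_gt0 subr_gt0. Qed.

Let partial_le N M A : measurable A ->
  \sum_(n < M) w n A <= \sum_(n < N) w n A + D * r ^+ N.
Proof.
move=> mA.
have mono (F : nat -> R) (p q : nat) : (forall n, 0 <= F n) -> (p <= q)%N ->
    \sum_(n < p) F n <= \sum_(n < q) F n.
  by move=> F0 pq; rewrite -(subnKC pq) big_split_ord/= lerDl; apply: sumr_ge0.
apply: (le_trans (mono (w^~ A) M (N + M)%N _ _)) => //; first exact: leq_addl.
rewrite big_split_ord/= lerD2l.
apply: (@le_trans _ _ (\sum_(i < M) r ^+ N * r ^+ i)).
  by apply: ler_sum => i _; rewrite -exprD; exact: w_le.
rewrite -mulr_sumr mulrC ler_pM2r//.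
have : (1 - r) * \sum_(i < M) r ^+ i <= 1 by rewrite geometric_sum gerBl ltW.
by rewrite -ler_pdivlMl ?subr_gt0// mulr1.
Qed.

Lemma parry_partial N A : measurable A ->
  ((\sum_(n < N) w n A)%:E <= parry A <= (\sum_(n < N) w n A + D * r ^+ N)%:E)%E.
Proof.
move=> mA; rewrite /parry /mseries; under eq_eseriesr do rewrite termE//.
have psum M : (\sum_(0 <= n < M) (w n A)%:E = (\sum_(n < M) w n A)%:E)%E.
  by rewrite big_mkord sumEFin.
apply/andP; split.
  rewrite -psum; apply: nneseries_lim_ge => n _ _; by rewrite lee_fin.
apply: lime_le; first by apply: is_cvg_nneseries => n _ _; rewrite lee_fin.
by apply: nearW => M; rewrite psum lee_fin; exact: partial_le.
Qed.

Let parry_fin : fin_num_fun parry.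
Proof.
move=> A mA; have /andP[p0 p1] := parry_partial 0 mA.
by rewrite ge0_fin_numE ?measure_ge0//; apply: le_lt_trans p1 _; rewrite ltry.
Qed.
HB.instance Definition _ := @Measure_isFinite.Build _ _ _ parry parry_fin.

Let parry_approx N A : measurable A ->
  0 <= fine (parry A) - \sum_(n < N) w n A <= D * r ^+ N.
Proof.
move=> mA; have := parry_partial N mA.
rewrite -[parry A]fineK; last exact: parry_fin.
by rewrite !lee_fin subr_ge0 lerBlDl.
Qed.

Lemma parry_ac : content_dominates (@lambda R) parry.
Proof.
move=> A mA A0; rewrite /parry /mseries eseries0// => n _ _.
rewrite termE// /w (_ : lambda _ = 0%E) ?mulr0//.
by apply: (@subset_measure0 _ _ _ (@lambda R) _ A) => //; exact: mI.
Qed.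

Lemma parry_setT_gt0 : 0 < fine (parry setT).
Proof.
have /andP[+ _] := parry_approx 1 measurableT.
rewrite big_ord1 /w expr0 mul1r setIT.
by rewrite (_ : t 0 = 1)// lambda_below ?ler01 ?lexx//=; lra.
Qed.

(** Since floor(beta t_n) = beta t_n - t_(n+1), the transfer operator sends the n-th term to the
    next one plus the constant r^n t_n - r^(n+1) t_(n+1). Partial sums telescope, up to boundary
    terms of size r^N. *)
Lemma parry_invariant A : measurable A -> parry (T_ beta @^-1` A) = parry A.
Proof.
move=> mA; have mTA : measurable (T_ beta @^-1` A).
  by apply: measurable_preimage => //; exact: measurable_T.
pose l := fine (lambda A).
have l01 : 0 <= l <= 1.
  by rewrite -!lee_fin fineK ?lambda_fin// measure_ge0 probability_le1.
have wS n : w n (T_ beta @^-1` A) = (r ^+ n * t n - r ^+ n.+1 * t n.+1) * l + w n.+1 A.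
  have e1 : lambda A = l%:E by rewrite fineK// lambda_fin.
  have e2 : lambda (below (t n.+1) `&` A) = (fine (lambda (below (t n.+1) `&` A)))%:E.
    by rewrite fineK// lambda_fin//; exact: mI.
  rewrite /w lambda_below_T// -/(t n.+1) e1 e2.
  move: (fine (lambda (below (t n.+1) `&` A))) => e.
  by rewrite -EFinM/= exprS /fracpart; field; rewrite gt_eqF.
have sumS N : \sum_(n < N) w n (T_ beta @^-1` A) - \sum_(n < N) w n A =
    w N A - r ^+ N * t N * l.
  elim: N => [|N IH].
    rewrite !big_ord0 /w !expr0 !mul1r (_ : t 0 = 1)// below1// setTI ?mul1r.
    by rewrite !subrr.
  have recr (F : nat -> R) : \sum_(n < N.+1) F n = \sum_(n < N) F n + F N.
    by rewrite big_ord_recr.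
  rewrite (recr (w^~ (T_ beta @^-1` A))) (recr (w^~ A)) wS.
  move/(canRL (subrK _)): IH => ->; set tN1 := t N.+1; ring.
rewrite -[LHS]fineK ?parry_fin// -[RHS]fineK ?parry_fin//; congr EFin.
apply/eqP; rewrite -subr_eq0 -normr_le0.
have r01 : 0 <= r < 1 by rewrite r1 (ltW r0).
apply: (@le_geometric R r _ _ (D + 1) 0 r01) => N _; rewrite add0r.
have := parry_approx N mA; have := parry_approx N mTA; have := sumS N.
have : 0 <= w N A <= r ^+ N by rewrite w_ge0 w_le.
have : 0 <= r ^+ N * t N * l <= r ^+ N.
  case/andP: l01 => l0 l1; case/andP: (t01 N) => tN0 tN1.
  rewrite !mulr_ge0 ?(ltW (rn0 N))//= -mulrA ler_piMr ?(ltW (rn0 N))//.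
  by rewrite mulr_ile1.
rewrite ler_norml; lra.
Qed.

Lemma ac_joint_exceptional (c : rat) (nu : {finite_measure set (X R) -> \bar R}) :
  irrational beta -> 0 < c ->
  (forall A, measurable A -> nu (T_ beta @^-1` A) = nu A) ->
  (forall A, measurable A -> nu (T_ (beta + ratr c) @^-1` A) = nu A) ->
  content_dominates (@lambda R) nu -> nu setT != 0%E -> exceptional beta c.
Proof.
move=> irr c0 inv1 inv2 ac nuT.
pose a := fine (nu setT); pose p := fine (parry setT).
have p0 : 0 < p := parry_setT_gt0.
have a0 : 0 < a.
  rewrite lt_neqAle fine_ge0// andbT eq_sym; apply: contra nuT => /eqP a0.
  by rewrite -[nu setT]fineK ?fin_num_measure//; apply/eqP; congr EFin.
pose m1 : {finite_measure set (X R) -> \bar R} := mscale (NngNum (ltW p0)) nu.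
pose m2 : {finite_measure set (X R) -> \bar R} := mscale (NngNum (ltW a0)) parry.
have m1E A : m1 A = (p%:E * nu A)%E by [].
have m2E A : m2 A = (a%:E * parry A)%E by [].
have eqm : forall A, measurable A -> m1 A = m2 A.
  apply: (ac_invariant_unique beta_gt1).
  - by move=> A mA; rewrite !m1E inv1.
  - by move=> A mA; rewrite !m2E parry_invariant.
  - by move=> A mA A0; rewrite m1E ac// mule0.
  - by move=> A mA A0; rewrite m2E parry_ac// mule0.
  - rewrite m1E m2E -[nu setT]fineK ?fin_num_measure// -[parry setT]fineK ?parry_fin//.
    by rewrite -!EFinM mulrC.
pose b := beta + ratr c.
have b0 : 0 < b by rewrite addr_gt0// ltr0q.
have mTb A : measurable A -> measurable (T_ b @^-1` A).
  by move=> mA; apply: measurable_preimage => //; exact: measurable_T.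
have invb A : measurable A -> parry (T_ b @^-1` A) = parry A.
  move=> mA; have := eqm _ (mTb _ mA); have := eqm _ mA.
  rewrite !m1E !m2E inv2// => -> /esym.
  rewrite -[parry A]fineK ?parry_fin// -[parry (_ @^-1` _)]fineK ?parry_fin//; last exact: mTb.
  by rewrite -!EFinM => -[] /(mulfI (lt0r_neq0 a0)) ->.
(* The constant b D: both truncation errors lie between 0 and D r^N, and their difference is
   multiplied by b. *)
apply: (@coincidence_exceptional R beta c (b * D)) => // N x x01.
have mB := measurable_below x.
have := parry_approx N mB; have := parry_approx N (mTb _ mB).
rewrite invb//.
have -> : \sum_(n < N) w n (below x) = \sum_(n < N) r ^+ n * Num.min (t n) x.
  apply: eq_bigr => n _; rewrite /w below_setI lambda_below//.
  by case/andP: (t01 n) => tn0 tn1; case/andP: x01 => x0 x1; rewrite le_min tn0 x0 ge_min tn1.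
have -> : \sum_(n < N) w n (T_ b @^-1` below x) =
   b^-1 * \sum_(n < N) r ^+ n * ((Num.floor (b * t n))%:~R * x + Num.min (fracpart (b * t n)) x).
  rewrite mulr_sumr; apply: eq_bigr => n _.
  by rewrite /w lambda_below_T_below// mulrCA.
set S1 := \sum_(n < N) r ^+ n * Num.min _ _; set S2 := \sum_(n < N) _ => h2 h1.
have -> : \sum_(n < N) r ^+ n * (b * Num.min (t n) x - (Num.floor (b * t n))%:~R * x -
    Num.min (fracpart (b * t n)) x) = b * (S1 - b^-1 * S2).
  rewrite mulrBr mulrA mulfV ?gt_eqF// mul1r /S1 mulr_sumr -sumrB.
  by apply: eq_bigr => n _; ring.
rewrite normrM gtr0_norm// -mulrA ler_pM2l// ler_norml; lra.
Qed.

End parry_measure.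

(** * The theorem *)

Section point_mass.
Context {R : realType}.

Lemma lambda_X0 : lambda [set X0 R] = 0%E.
Proof. by rewrite /lambda image_set1 lebesgue_measure_set1. Qed.

Lemma measurable_X0 : measurable [set X0 R].
Proof.
rewrite -[[set _]]setTI (_ : [set X0 R] = @toR R @^-1` [set 0]).
  exact: measurable_toR.
apply/seteqP; split => x /=; first by move=> ->.
by move=> x0; apply: toR_inj.
Qed.

Lemma T_X0 (b : R) : T_ b (X0 R) = X0 R.
Proof. by apply: toR_inj; rewrite toR_T mulr0 /fracpart floor0 subr0. Qed.

Lemma delta0E (A : set (X R)) : delta0 R A = (X0 R \in A)%:R%:E.
Proof. by rewrite /delta0/= diracE. Qed.

Lemma delta0_preimage (b : R) (A : set (X R)) :
  delta0 R (T_ b @^-1` A) = delta0 R A.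
Proof.
rewrite !delta0E; congr (_%:R%:E); congr nat_of_bool.
by apply/idP/idP; rewrite !inE /preimage/= T_X0.
Qed.

Lemma eq_delta0 (mu : probability (X R) R) :
  mu (~` [set X0 R]) = 0%E -> mu =m delta0 R.
Proof.
move=> mu0 A mA; have mX := measurable_X0; have mC := measurableC mX.
have mI B : measurable B -> mu (B `&` ~` [set X0 R]) = 0%E.
  by move=> mB; apply: subset_measure0 mu0 => //; exact: measurableI.
have mu1 : mu [set X0 R] = 1%E.
  rewrite -(@probability_setT _ _ _ mu) -(setUv [set X0 R]).
  have U : mu ([set X0 R] `|` ~` [set X0 R]) = (mu [set X0 R] + mu (~` [set X0 R]))%E.
    exact: (measureU mu mX mC (setICr _)).
  by rewrite U mu0 adde0.
rewrite delta0E (_ : mu A = (mu (A `\` [set X0 R]) + mu (A `&` [set X0 R]))%E).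
  rewrite setDE mI// add0e; have [AX|AX] := boolP (X0 R \in A).
    by rewrite setIidr ?mu1// => x ->; rewrite inE in AX.
  rewrite (_ : A `&` _ = set0) ?measure0//; apply/seteqP; split => // x [Ax xX].
  by move: AX; rewrite notin_setE; apply; rewrite -xX.
exact: measureDI.
Qed.

End point_mass.

Section off_zero.
Context {R : realType}.
Variables (mu : {finite_measure set (X R) -> \bar R}) (beta : R) (c : rat).
Hypotheses (beta_gt1 : 1 < beta) (beta_irr : irrational beta) (c_gt0 : 0 < c).
Let b := beta + ratr c.
Hypothesis mu_beta : forall A, measurable A -> mu (T_ beta @^-1` A) = mu A.
Hypothesis mu_b : forall A, measurable A -> mu (T_ b @^-1` A) = mu A.

Let b_gt1 : 1 < b.
Proof. by rewrite (lt_trans beta_gt1)// ltrDl ltr0q. Qed.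

(** The restriction of [mu] to a maximal null set [N] is jointly invariant and singular, hence sits
    at 0. So [N] and the point 0 differ by a [mu]-null set, and removing the point amounts to
    removing the singular part. *)
Lemma off_zero_part :
  let nu A := mu (A `\` [set X0 R]) in
  [/\ forall A, measurable A -> nu (T_ beta @^-1` A) = nu A,
      forall A, measurable A -> nu (T_ b @^-1` A) = nu A &
      forall A, measurable A -> lambda A = 0%E -> nu A = 0%E].
Proof.
move=> nu; have [N [mN N0 Nmax]] := maximal_null_set mu (@lambda R).
have mX := @measurable_X0 R.
have XN : mu ([set X0 R] `\` N) = 0%E by apply: Nmax => //; exact: lambda_X0.
pose muN : {finite_measure set (X R) -> \bar R} := mrestr mu mN.
have inv_beta := invariant_null_part mN N0 Nmax (measurable_T beta) mu_beta (lambda_preimage0 beta_gt1).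
have inv_b := invariant_null_part mN N0 Nmax (measurable_T b) mu_b (lambda_preimage0 b_gt1).
have NX : mu (N `\` [set X0 R]) = 0%E.
  rewrite setDE setIC; apply: (joint_invariant_singular (mu := muN) beta_irr c_gt0 inv_beta inv_b mN N0).
  by rewrite /muN/= /mrestr setICl measure0.
have muDI A B : measurable A -> measurable B ->
    mu A = (mu (A `\` B) + mu (A `&` B))%E by move=> mA mB; exact: measureDI.
have sub0 A B : measurable A -> measurable B -> A `<=` B -> mu B = 0%E -> mu A = 0%E.
  by move=> mA mB AB B0; exact: (@subset_measure0 _ _ _ mu A B).
have nuE A : measurable A -> nu A = mu (A `\` N).
  move=> mA; have mAX := measurableD mA mX; have mAN := measurableD mA mN.
  rewrite /nu (muDI _ _ mAX mN) (muDI _ _ mAN mX).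
  rewrite [X in (_ + X)%E = _](sub0 _ _ _ _ _ NX); [|exact: measurableI|exact: measurableD|].
    rewrite [X in _ = (_ + X)%E](sub0 _ _ _ _ _ XN); [|exact: measurableI|exact: measurableD|].
      by rewrite !setDE setIAC.
    by move=> x [[_ Nx] Xx].
  by move=> x [[_ Nx] Xx].
have mpre d A : measurable A -> measurable (T_ d @^-1` A : set (X R)).
  by move=> mA; apply: measurable_preimage => //; exact: measurable_T.
split=> [A mA|A mA|A mA A0].
- rewrite !nuE//; last exact: mpre.
  exact: (invariant_ac_part mN N0 Nmax (measurable_T beta) mu_beta (lambda_preimage0 beta_gt1)).
- rewrite !nuE//; last exact: mpre.
  exact: (invariant_ac_part mN N0 Nmax (measurable_T b) mu_b (lambda_preimage0 b_gt1)).
- by rewrite nuE// Nmax.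
Qed.

End off_zero.

(** * The explicit density for a quadratic base *)

Section exceptional_density.
Context {R : realType}.
Variables (beta : R) (u v : nat).
Hypotheses (beta_gt1 : 1 < beta) (uv : quadratic_coeffs beta u v).
Let a := beta - u%:R.
Let Z := 1 + a / beta.

Let beta0 : 0 < beta. Proof. exact: lt_trans beta_gt1. Qed.

Lemma quadratic_step : a = v%:R / beta /\ 0 < a < 1.
Proof.
case: uv => /andP[v1 vu] e.
have av : beta * a = v%:R by rewrite /a; move: e; rewrite expr2; lra.
have aE : a = v%:R / beta by rewrite -av mulrAC divff ?mul1r// gt_eqF.
have a0 : 0 < a by rewrite aE divr_gt0// ltr0n.
split => //; rewrite a0/= aE ltr_pdivrMr// mul1r.
by apply: (@le_lt_trans _ _ u%:R); [rewrite ler_nat|rewrite -subr_gt0].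
Qed.

Let aE : beta * a = v%:R.
Proof. by have [-> _] := quadratic_step; rewrite mulrCA divff ?mulr1// gt_eqF. Qed.

Let a01 : 0 < a < 1. Proof. by have [] := quadratic_step. Qed.
Let a0 : 0 < a. Proof. by case/andP: a01. Qed.
Let a1 : a < 1. Proof. by case/andP: a01. Qed.
Let Z0 : 0 < Z. Proof. by rewrite addr_gt0// divr_gt0. Qed.

Let r0 : 0 <= beta^-1. Proof. by rewrite invr_ge0 ltW. Qed.

Let m : {measure set (X R) -> \bar R} :=
  measure_add (@lambda R) (mscale (NngNum r0) (mrestr (@lambda R) (measurable_below a))).

Let l (A : set (X R)) : R := fine (lambda A).
Let e (A : set (X R)) : R := fine (lambda (below a `&` A)).

Let mI A : measurable A -> measurable (below a `&` A).
Proof. by move=> mA; apply: measurableI => //; exact: measurable_below. Qed.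

Let lE A : measurable A -> lambda A = (l A)%:E.
Proof. by move=> mA; rewrite fineK// lambda_fin. Qed.

Let eE A : measurable A -> lambda (below a `&` A) = (e A)%:E.
Proof. by move=> mA; rewrite fineK// lambda_fin//; exact: mI. Qed.

Let mE A : measurable A -> m A = (l A + beta^-1 * e A)%:E.
Proof.
move=> mA; rewrite EFinD EFinM -lE// -eE// setIC; exact: measure_addE.
Qed.

(** Here [lambda] is only the fallback for a zero or infinite total mass; the mass of [m] is Z >
    0. *)
Definition quadratic_measure : probability (X R) R := mnormalize m (@lambda R).

Lemma quadratic_measureE A : measurable A ->
  quadratic_measure A = ((l A + beta^-1 * e A) / Z)%:E.
Proof.
move=> mA; have mT : m setT = Z%:E.
  rewrite mE// /l /e setIT probability_setT lambda_below ?(ltW a0) ?(ltW a1)//=.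
  by rewrite mulrC.
rewrite /quadratic_measure/= /mnormalize mT/= eqe gt_eqF//=.
by rewrite mE// -EFinM.
Qed.

Lemma quadratic_measure_ac : content_dominates (@lambda R) quadratic_measure.
Proof.
move=> A mA A0; rewrite quadratic_measureE// /l /e A0.
rewrite (_ : lambda (below a `&` A) = 0%E) ?mulr0 ?addr0 ?mul0r//.
by apply: (@subset_measure0 _ _ _ (@lambda R) _ A) => //; exact: mI.
Qed.

(** Serves both bases: beta and beta + 1 have fractional part [a], while beta a = v and (beta + 1) a
    = v + a, so [0, a) leaves no partial branch in one case and reproduces itself in the other. *)
Let step (b : R) (p n : nat) A : 0 < b -> b = p%:R + a -> b * a = n%:R + fracpart (b * a) ->
  measurable A ->
  l (T_ b @^-1` A) = b^-1 * (p%:R * l A + e A) /\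
  e (T_ b @^-1` A) = b^-1 * (n%:R * l A + fine (lambda (below (fracpart (b * a)) `&` A))).
Proof.
move=> b0 bE baE mA.
have fb : Num.floor b = p.
  by apply/floor_def; rewrite intrD -pmulrn bE lerDl ltrD2l a1 (ltW a0).
have fba : Num.floor (b * a) = n.
  apply/floor_def; rewrite intrD -pmulrn baE lerDl ltrD2l.
  by rewrite frac_ge0 frac_lt1.
split.
  rewrite /l -[T_ b @^-1` A]setTI -(below1 (lexx 1)) lambda_below_T ?ler01 ?lexx//.
  rewrite mulr1 fb /fracpart fb -pmulrn {2}bE addrAC subrr add0r.
  by rewrite eE// lE// -EFinM.
rewrite /e lambda_below_T// ?(ltW a0) ?(ltW a1)// fba -pmulrn lE//.
set E2 := lambda (below (fracpart _) `&` A).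
have -> : E2 = (fine E2)%:E.
  by rewrite fineK// lambda_fin//; apply: measurableI => //; exact: measurable_below.
by rewrite -EFinM.
Qed.

Lemma quadratic_measure_beta A : measurable A ->
  quadratic_measure (T_ beta @^-1` A) = quadratic_measure A.
Proof.
move=> mA; rewrite !quadratic_measureE//; last first.
  by apply: measurable_preimage => //; exact: measurable_T.
have fr : fracpart (beta * a) = 0.
  by rewrite aE /fracpart pmulrn intrKfloor subrr.
have [-> ->] : l (T_ beta @^-1` A) = beta^-1 * (u%:R * l A + e A) /\
    e (T_ beta @^-1` A) = beta^-1 * (v%:R * l A + fine (lambda (below (fracpart (beta * a)) `&` A))).
  by apply: step => //; [rewrite /a; ring|rewrite fr addr0].
rewrite fr below0// set0I measure0/= addr0 -aE; congr (_ / _)%:E.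
by rewrite /a; field; rewrite gt_eqF.
Qed.

(** Comes down to u + 1 + v / beta = beta + 1 for the constant part of the density, and to (1 + 1 /
    beta) / (beta + 1) = 1 / beta for the part on [0, a). *)
Lemma quadratic_measure_beta1 A : measurable A ->
  quadratic_measure (T_ (beta + 1) @^-1` A) = quadratic_measure A.
Proof.
move=> mA; rewrite !quadratic_measureE//; last first.
  by apply: measurable_preimage => //; exact: measurable_T.
have b0 : 0 < beta + 1 by rewrite addr_gt0.
have fr : fracpart ((beta + 1) * a) = a.
  rewrite mulrDl mul1r aE addrC pmulrn fracDz frac_id//.
  by rewrite a1 ltW.
have [-> ->] : l (T_ (beta + 1) @^-1` A) = (beta + 1)^-1 * (u.+1%:R * l A + e A) /\
    e (T_ (beta + 1) @^-1` A) = (beta + 1)^-1 * (v%:R * l A +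
      fine (lambda (below (fracpart ((beta + 1) * a)) `&` A))).
  apply: step => //; first by rewrite /a -natr1; ring.
  by rewrite fr mulrDl mul1r aE.
rewrite fr -/(e A) -natr1 -aE; congr (_ / _)%:E.
by rewrite /a; field; rewrite !gt_eqF.
Qed.

Lemma quadratic_measure_density A : measurable A ->
  quadratic_measure A =
  (\int[@lambda R]_(x in A)
    ((1 + beta^-1 * \1_(`[0%R, a[ : set R) (toR x)) / (1 + a / beta))%:E)%E.
Proof.
move=> mA; rewrite quadratic_measureE//.
have Zi : 0 <= Z^-1 by rewrite invr_ge0 ltW.
transitivity (\int[@lambda R]_(x in A) ((Z^-1)%:E +
    (beta^-1 / Z)%:E * (\1_(below a) x)%:E))%E; last first.
  apply: eq_integral => x _; rewrite -EFinM -EFinD; congr EFin.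
  rewrite (_ : \1_(below a) x = \1_(`[0, a[ : set R) (toR x)) /Z; first by ring.
  rewrite !indicE; congr (nat_of_bool _)%:R; apply/idP/idP; rewrite !inE /below/= in_itv/=.
    by rewrite toR_ge0.
  by case/andP.
rewrite ge0_integralD//; last 2 first.
- by move=> x _; rewrite -EFinM lee_fin !mulr_ge0.
- apply/measurable_EFinP; apply: measurable_funM => //.
  by apply: measurable_funTS; apply: measurable_indic; exact: measurable_below.
rewrite integral_cst// ge0_integralZl//; last 2 first.
- apply/measurable_EFinP; apply: measurable_funTS.
  by apply: measurable_indic; exact: measurable_below.
- by rewrite lee_fin mulr_ge0.
rewrite integral_indic//; last exact: measurable_below.
rewrite [X in (_ = _ * X + _)%E](lE mA) [X in (_ = _ + _ * X)%E](eE mA).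
rewrite -!EFinM -EFinD; congr EFin.
by rewrite mulrDl mulrC; congr (_ + _); ring.
Qed.

(** The explicit measure witnesses existence, so [get] returns some absolutely continuous invariant
    probability, and ergodic uniqueness identifies it. *)
Lemma renyi_parry_quadratic b : (b = beta \/ b = beta + 1) ->
  nu_ b =m quadratic_measure.
Proof.
move=> bb; have b1 : 1 < b.
  by case: bb => ->//; rewrite (lt_trans beta_gt1)// ltrDl.
have Q : exists nu : probability (X R) R,
    invariant_measure (T_ b) nu /\ nu `<< @lambda R.
  exists quadratic_measure; split; last by apply/null_content_dominatesP; exact: quadratic_measure_ac.
  by move=> A mA; case: bb => ->; [exact: quadratic_measure_beta|exact: quadratic_measure_beta1].
have [inv /null_content_dominatesP ac] := getPex Q.
move=> A mA; apply: (ac_invariant_unique (nu1 := nu_ b) (nu2 := quadratic_measure) b1) => //.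
- by move=> B mB; case: bb => ->; [exact: quadratic_measure_beta|exact: quadratic_measure_beta1].
- exact: quadratic_measure_ac.
- exact: etrans (@probability_setT _ _ _ (nu_ b))
    (esym (@probability_setT _ _ _ quadratic_measure)).
Qed.

End exceptional_density.

Unset Implicit Arguments.
Set Strict Implicit.

Theorem corollary1p4 (R : realType) (beta : R) (c : rat)
    (beta_gt1 : 1 < beta) (beta_irr : irrational beta) (c_gt0 : 0 < c) :
  [/\ (exceptional beta c ->
        forall mu : probability (X R) R,
          joint_invariant beta c mu <-> exists t : R, mixing_parameter beta mu t),
      (~ exceptional beta c ->
        forall mu : probability (X R) R,
          joint_invariant beta c mu <-> mu =m delta0 R),
      (exceptional beta c ->
        [/\ nu_ beta =m nu_ (beta + 1),
            (forall u v : nat, quadratic_coeffs beta u v ->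
              let a := beta - u%:R in
              [/\ a = v%:R / beta, 0 < a < 1 &
                  forall A : set (X R), measurable A ->
                    nu_ beta A =
                    (\int[@lambda R]_(x in A)
                      ((1 + beta^-1 * \1_(`[0, a[ : set R) (toR x))
                        / (1 + a / beta))%:E)%E]) &
            (forall mu : probability (X R) R, joint_invariant beta c mu ->
              (exists! t : R, mixing_parameter beta mu t) /\
              (forall t : R, mixing_parameter beta mu t ->
                t%:E = (1 - mu [set X0 R])%E))]) &
      (forall mu : probability (X R) R,
        (joint_invariant beta c mu /\ mutually_singular mu (@lambda R)) <->
        mu =m delta0 R)].
Proof.
have mX := @measurable_X0 R.
have mpre d A : measurable A -> measurable (T_ d @^-1` A : set (X R)).
  by move=> mA; apply: measurable_preimage => //; exact: measurable_T.
have delta_joint (mu : probability (X R) R) : mu =m delta0 R -> joint_invariant beta c mu.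
  move=> mud; split => A mA; rewrite /pushforward !mud ?delta0_preimage//; exact: mpre.
have singular_delta (mu : probability (X R) R) :
    (joint_invariant beta c mu /\ mutually_singular mu (@lambda R)) <-> mu =m delta0 R.
  split=> [[[inv1 inv2] [A [mA muA lA]]]|mud].
    apply: eq_delta0.
    apply: (joint_invariant_singular (mu := mu) beta_irr c_gt0 inv1 inv2 (measurableC mA) lA).
    by rewrite setCK.
  split; first exact: delta_joint.
  exists (~` [set X0 R]); split.
  - exact: measurableC.
  - rewrite mud; last exact: measurableC.
    by rewrite delta0E memNset//= => /(_ erefl).
  - by rewrite setCK lambda_X0.
pose off (mu : probability (X R) R) : {finite_measure set (X R) -> \bar R} :=
  mrestr mu (measurableC mX).
have offE mu A : off mu A = mu (A `\` [set X0 R]) by [].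
have off_part (mu : probability (X R) R) : joint_invariant beta c mu ->
    [/\ forall A, measurable A -> off mu (T_ beta @^-1` A) = off mu A,
        forall A, measurable A -> off mu (T_ (beta + ratr c) @^-1` A) = off mu A &
        content_dominates (@lambda R) (off mu)].
  by move=> [inv1 inv2]; exact: (off_zero_part (mu := mu) beta_gt1 beta_irr c_gt0 inv1 inv2).
have nonexc : ~ exceptional beta c -> forall mu : probability (X R) R,
    joint_invariant beta c mu <-> mu =m delta0 R.
  move=> nex mu; split; last exact: delta_joint.
  move=> /off_part[inv1 inv2 ac]; apply: eq_delta0.
  rewrite -setTD -offE; apply/eqP; apply: contra_notT nex.
  exact: ac_joint_exceptional inv1 inv2 ac.
have nu_quad : exceptional beta c -> exists Q : probability (X R) R,
  [/\ nu_ beta =m Q, nu_ (beta + 1) =m Q,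
      forall A, measurable A -> Q (T_ beta @^-1` A) = Q A,
      forall A, measurable A -> Q (T_ (beta + 1) @^-1` A) = Q A &
      content_dominates (@lambda R) Q].
  move=> [_ [_ [u [v uv]]]]; exists (quadratic_measure u beta_gt1); split.
  - by apply: (renyi_parry_quadratic beta_gt1 uv); left.
  - by apply: (renyi_parry_quadratic beta_gt1 uv); right.
  - exact: (quadratic_measure_beta beta_gt1 uv).
  - exact: (quadratic_measure_beta1 beta_gt1 uv).
  - exact: (quadratic_measure_ac beta_gt1 uv).
have mix_param (mu : probability (X R) R) t : exceptional beta c -> mixing_parameter beta mu t ->
    t%:E = (1 - mu [set X0 R])%E.
  move=> /nu_quad[Q [nuQ _ _ _ acQ]] [_ mix].
  (* Evaluate the mixture at the point 0, which [nu_ beta] does not charge. *)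
  rewrite mix// /mixture delta0E mem_set// nuQ// acQ//; last exact: lambda_X0.
  by rewrite mule1 mule0 adde0 -EFinB opprB addrCA subrr addr0.
have mix_ex (mu : probability (X R) R) : exceptional beta c -> joint_invariant beta c mu ->
    exists t, mixing_parameter beta mu t.
  move=> ex jmu; have [Q [nuQ _ invQ _ acQ]] := nu_quad ex.
  have [inv1 _ ac] := off_part _ jmu.
  (* The part of [mu] off 0 is compared with [t] times [Q], of the same mass; multiplying rather
     than dividing by [t] covers t = 0. *)
  pose t := fine (off mu setT).
  have t0 : 0 <= t by rewrite fine_ge0.
  have tE : off mu setT = t%:E by rewrite fineK// fin_num_measure.
  have muDI A : measurable A -> (mu A = off mu A + mu (A `&` [set X0 R]))%E.
    by move=> mA; rewrite offE; exact: measureDI.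
  have mu0 : mu [set X0 R] = (1 - t)%:E.
    have := muDI _ measurableT; rewrite setTI tE probability_setT => /esym e.
    by rewrite EFinB -e addeAC subee// add0e.
  have t1 : t <= 1 by rewrite -subr_ge0 -lee_fin -mu0.
  exists t; split; first by rewrite t0.
  move=> A mA; rewrite /mixture muDI// addeC; congr (_ + _)%E.
    rewrite delta0E; have [AX|AX] := boolP (X0 R \in A).
      by rewrite mule1 setIidr ?mu0// => x ->; rewrite inE in AX.
    rewrite mule0 (_ : A `&` _ = set0) ?measure0//; apply/seteqP; split => // x [Ax xX].
    by move: AX; rewrite notin_setE; apply; rewrite -xX.
  pose m2 : {finite_measure set (X R) -> \bar R} := mscale (NngNum t0) Q.
  have m2E B : m2 B = (t%:E * Q B)%E by [].
  rewrite nuQ// -m2E; apply: (ac_invariant_unique (nu1 := off mu) (nu2 := m2) beta_gt1) => //.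
  - by move=> B mB; rewrite !m2E invQ.
  - by move=> B mB B0; rewrite m2E acQ// mule0.
  - by rewrite tE m2E (@probability_setT _ _ _ Q) mule1.
split => //.
- move=> ex mu; split=> [|[t [t01 mix]]]; first exact: mix_ex.
  have [Q [nuQ _ invQ invQ1 _]] := nu_quad ex.
  have -> : joint_invariant beta c = joint_invariant beta 1 by rewrite ex.1.
  split => A mA; rewrite /pushforward !mix// ?/mixture; try exact: mpre.
    by rewrite delta0_preimage !nuQ ?invQ//; exact: mpre.
  by rewrite rmorph1 delta0_preimage !nuQ ?invQ1//; exact: mpre.
- move=> ex; have [Q [nuQ nuQ1 _ _ _]] := nu_quad ex; split.
  + by move=> A mA; rewrite nuQ// nuQ1.
  + move=> u v uv a; have [aE a01] := quadratic_step beta_gt1 uv; split => // A mA.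
    rewrite (renyi_parry_quadratic beta_gt1 uv (or_introl erefl))//.
    exact: (quadratic_measure_density beta_gt1 uv).
  + move=> mu jmu; split; last by move=> t; exact: mix_param.
    have [t tm] := mix_ex mu ex jmu; exists t; split => // t' t'm.
    by apply: EFin_inj; rewrite (mix_param mu t ex tm) (mix_param mu t' ex t'm).
Qed.
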